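(* Let $\Omega\subset\mathbb{R}^n$ be a bounded Borel set and let $F\subset\overline{\Omega}$ be closed such that for every $x\in F$ and $\delta>0$ $$\mathcal{L}^n(B(x,\delta)\cap\Omega)>0$$ and $\mathcal{L}^n(F\cap\Omega)=0$. Furthermore, let $\sigma$ be a (signed) Radon measure on $F$. Then there exists $\mu\in\mathrm{ba}(\Omega,\mathcal{B}(\Omega),\mathcal{L}^n)$ such that for all $\phi\in C_c(\Omega)$ $$\int_\Omega\phi\,d\mu=\int_F\phi\,d\sigma .$$ Furthermore, $|\mu|(\Omega)=|\sigma|(F)$ and $\mu$ is pure.
   Context: $\mathcal{B}(\Omega)$ is the Borel $\sigma$-algebra of $\Omega$, $\mathcal{L}^n$ is Lebesgue measure and $B(x,\delta)$ is the open ball. A measure is a finitely additive real-valued set function; a $\sigma$-measure is a countably additive one. $\mathrm{ba}(\Omega,\mathcal{B}(\Omega))$ is the vector lattice (with setwise order) of bounded measures on $\mathcal{B}(\Omega)$, $|\mu|$ is the total variation, and $(\mu\wedge\nu)(A)=\inf\{\mu(A')+\nu(A\setminus A'):A'\in\mathcal{B}(\Omega),A'\subset A\}$. $\mathrm{ba}(\Omega,\mathcal{B}(\Omega),\mathcal{L}^n)$ is the set of $\mu\in\mathrm{ba}(\Omega,\mathcal{B}(\Omega))$ such that $\mathcal{L}^n(B)=0$ implies $\mu(B)=0$ for all $B\in\mathcal{B}(\Omega)$. $\mu$ is pure if $|\mu|\wedge|\nu|=0$ for all bounded $\sigma$-measures $\nu$ on $\mathcal{B}(\Omega)$. $C_c(\Omega)$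 is the space of continuous functions on $\Omega$ with compact support in $\Omega$, extended by $0$ to $\overline{\Omega}$ for integration over $F$. For bounded measurable $f$, $\int_\Omega f\,d\mu:=\lim_k\int_\Omega s_k\,d\mu$, where $s_k$ are simple functions converging to $f$ in measure $|\mu|$ (i.e. $|\mu|^*\{|s_k-f|>\varepsilon\}\to0$ for all $\varepsilon>0$, with $|\mu|^*(B)=\inf\{|\mu|(A):A\in\mathcal B(\Omega),B\subset A\}$) and with $\int_\Omega|s_k-s_l|\,d|\mu|\to0$. Radon measures here are countably additive, real-valued (possibly signed) regular Borel measures. *)

(* Defs.v *)
From HB Require Import structures.
From mathcomp Require Import all_boot all_order all_algebra.
From mathcomp Require Import all_classical all_reals all_analysis.

Set Implicit Arguments.
Unset Strict Implicit.
Unset Printing Implicit Defensive.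

Import Order.TTheory GRing.Theory Num.Theory.
Import numFieldNormedType.Exports HBSimple.

Local Open Scope classical_set_scope.
Local Open Scope ring_scope.

(* R^n with its Borel sigma-algebra.  The type is convertible to 'rV[R]_n, which
   carries the topology. *)
Notation borelRn R n := (g_sigma_algebraType (@open 'rV[R]_n)).

Definition euclidean_norm {R : realType} {n : nat} (x : 'rV[R]_n) : R :=
  Num.sqrt (\sum_(i < n) (x ord0 i) ^+ 2).

(* The library norm on 'rV[R]_n is the sup norm, hence its own definition. *)
Definition euclidean_ball {R : realType} {n : nat} (x : 'rV[R]_n) (r : R) :
    set 'rV[R]_n :=
  [set y | euclidean_norm (y - x) < r].

Definition box {R : realType} {n : nat} (a b : 'rV[R]_n) : set 'rV[R]_n :=
  [set x | forall i, a ord0 i <= x ord0 i <= b ord0 i].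

(* The maximum gives volume 0 to an empty box when 0 < n. *)
Definition box_volume {R : realType} {n : nat} (a b : 'rV[R]_n) : R :=
  \prod_(i < n) Num.max 0 (b ord0 i - a ord0 i).

(* Lebesgue measure of a Borel set, given by the Lebesgue outer measure.  The
   covers are indexed by arbitrary sets of naturals, so that they may be finite
   or empty; this matters for n = 0, where no box has volume 0. *)
Definition lebesgue_Rn {R : realType} {n : nat} (A : set 'rV[R]_n) : \bar R :=
  ereal_inf [set v | exists (J : set nat) (a b : nat -> 'rV[R]_n),
    A `<=` \bigcup_(k in J) box (a k) (b k) /\
    v = \esum_(k in J) (box_volume (a k) (b k))%:E].

Section finitely_additive_measures.
Context {d : measure_display} {T : measurableType d} {R : realType}.
Implicit Types (D A B : set T) (mu nu : set T -> \bar R).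

(* A set function on the measurable subsets of a measurable set D is identified
   with its extension A |-> mu (A `&` D) to all measurable sets of T. *)
Definition carried_by mu D : Prop :=
  forall A, measurable A -> mu A = mu (A `&` D).

Definition bounded_set_function mu : Prop :=
  exists M : R, forall A, measurable A -> (`|mu A| <= M%:E)%E.

Definition variation_measure mu A : \bar R :=
  ereal_sup [set v | exists (k : nat) (P : 'I_k -> set T),
    [/\ forall i, measurable (P i), trivIset setT P, \bigcup_i P i = A &
        v = (\sum_(i < k) `|mu (P i)|)%E]].

Definition meet_set_function mu nu A : \bar R :=
  ereal_inf [set (mu B + nu (A `\` B))%E | B in
    [set B | measurable B /\ B `<=` A]].

Definition ba (mu : {additive_charge set T -> \bar R}) D : Prop :=
  carried_by mu D /\ bounded_set_function mu.

Definition ba_dominated (mu : {additive_charge set T -> \bar R}) D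
    (lambda : set T -> \bar R) : Prop :=
  ba mu D /\
  forall B, measurable B -> B `<=` D -> lambda B = 0%E -> mu B = 0%E.

Definition pure (mu : {additive_charge set T -> \bar R}) D : Prop :=
  forall nu : {charge set T -> \bar R}, ba nu D ->
  forall A, measurable A -> A `<=` D ->
    meet_set_function (variation_measure mu) (variation_measure nu) A = 0%E.

Definition outer_set_function mu D B : \bar R :=
  ereal_inf [set mu A | A in [set A | [/\ measurable A, A `<=` D & B `<=` A]]].

(* s represents simple functions on D; its values outside D are irrelevant for
   mu carried by D. *)
Definition approximating mu D (f : T -> R) (s : nat -> {sfun T >-> R}) : Prop :=
  (forall e : R, 0 < e ->
    outer_set_function (variation_measure mu) D
      (D `&` [set x | e < `|s k x - f x|]) @[k --> \oo] --> 0%E) /\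
  (forall e : R, 0 < e -> \forall k & l \near \oo,
    (sintegral (variation_measure mu) (fun x => (`|s k x - s l x|)%R) < e%:E)%E).

(* I is the value of the integral of f over D: approximating sequences exist and
   I is the limit of the integrals along each of them. *)
Definition is_integral mu D (f : T -> R) (I : R) : Prop :=
  (exists s, approximating mu D f s) /\
  forall s, approximating mu D f s ->
    sintegral mu (s k) @[k --> \oo] --> I%:E.

End finitely_additive_measures.

Definition radon_on {R : realType} {n : nat}
    (sigma : {charge set (borelRn R n) -> \bar R}) (F : set 'rV[R]_n) : Prop :=
  carried_by sigma F /\
  forall (A : set (borelRn R n)) (e : R), measurable A -> A `<=` F -> 0 < e ->
    exists K U : set 'rV[R]_n,
      [/\ compact K, open U, K `<=` A, A `<=` U &
          (variation_measure sigma ((U `&` F) `\` K : set (borelRn R n)) < e%:E)%E].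

(* Continuous functions on Omega with compact support in Omega, extended by 0. *)
Definition continuous_compact_support {R : realType} {n : nat}
    (Omega : set 'rV[R]_n) (phi : 'rV[R]_n -> R) : Prop :=
  [/\ {within Omega, continuous phi},
      forall x, ~ Omega x -> phi x = 0 &
      compact (Omega `&` closure [set x | phi x != 0])].

(* Main.v *)
(**
For each [x] in [F] the sets containing some [V `&` Omega `\` N], with [V] a
neighborhood of [x] and [N] null, form a proper filter, by the density
hypothesis; let [U x] be an ultrafilter refining it. Extend [sigma] to a
finitely additive [tau] on all subsets with the same variation bounds, and put
[mu A := tau {x in F | A in U x}]. Since [A |-> {x in F | A in U x}] is a
Boolean homomorphism, [mu] is finitely additive with variation at most that of
[sigma]; it ignores null sets and lives on every neighborhood of [F] minus [F],
whence purity. Functions in [C_c(Omega)] converge along [U x] to their value at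
[x], which gives the equality of the integrals, and regularity of [sigma] gives the
converse bound on the variation. No additivity of Lebesgue measure is needed
beyond the fact that null sets form an ideal.
*)

Require Import Defs.
From HB Require Import structures.
From mathcomp Require Import all_boot all_order all_algebra.
From mathcomp Require Import all_classical all_reals all_analysis.
From mathcomp Require Import measurable_realfun ring lra zify.

Import Order.TTheory GRing.Theory Num.Theory.
Import numFieldNormedType.Exports.

Local Open Scope classical_set_scope.
Local Open Scope ring_scope.

(** * Finitely additive set functions on a class of sets *)

Definition additive_on {T : Type} {V : nmodType} (C : set (set T))
    (m : set T -> V) : Prop :=
  forall A B, C A -> C B -> A `&` B = set0 -> m (A `|` B) = m A + m B.

Lemma additive_on0 (T : Type) (V : zmodType) (C : set (set T))
    (m : set T -> V) :
  C set0 -> additive_on C m -> m set0 = 0.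
Proof.
move=> C0 /(_ set0 set0 C0 C0); rewrite setI0 setU0 => /(_ erefl).
by rewrite -[LHS]addr0 => /addrI.
Qed.

Lemma additive_on_bigcup (T : Type) (V : zmodType) (C : set (set T))
    (m : set T -> V) (I : finType) (P : I -> set T) :
  C set0 -> (forall A B, C A -> C B -> C (A `|` B)) ->
  additive_on C m -> (forall i, C (P i)) -> trivIset setT P ->
  m (\bigcup_i P i) = \sum_i m (P i).
Proof.
move=> C0 CU addm CP /trivIsetP tP.
have key (s : seq I) : uniq s -> C (\bigcup_(i in [set` s]) P i) /\
    m (\bigcup_(i in [set` s]) P i) = \sum_(i <- s) m (P i).
  elim: s => [_|i s IH /= /andP[nis us]].
    by rewrite set_nil bigcup_set0 big_nil (additive_on0 _ _ _ _ C0 addm).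
  have [CB mB] := IH us.
  rewrite bigcup_seq !big_cons -mB -!bigcup_seq; split; first exact: CU.
  apply: addm => //; rewrite -subset0 => x [Pix [j /= js Pjx]].
  have ij : i != j by apply: contraNneq nis => ->.
  have : (P i `&` P j) x by [].
  by rewrite tP.
have [_ <-] := key (index_enum I) (index_enum_uniq I).
by congr m; apply: eq_bigcupl; split=> // i _ /=; rewrite mem_index_enum.
Qed.

(** * Total variation of a finitely additive charge *)

Section variation.
Context {d : measure_display} {T : measurableType d} {R : realType}.
Variable m : {additive_charge set T -> \bar R}.
Implicit Types A B : set T.

Lemma acharge_fin A : measurable A -> m A \is a fin_num.
Proof. exact: fin_num_measure. Qed.

Lemma acharge_additive_on : additive_on measurable (fine \o m).
Proof.
move=> A B mA mB AB0 /=.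
have := @charge_semi_additive _ _ _ m (bigcup2 A B) 2%N.
rewrite -bigcup_mkord bigcup2inE big_ord_recl big_ord1 /= => ->.
- by rewrite fineD // acharge_fin.
- by move=> [|[|[]]] /=.
- move=> [|[|i]] [|[|j]] /= _ _ // [x []] //.
  + by move=> Ax Bx; have : (A `&` B) x by []; rewrite AB0.
  + by move=> Bx Ax; have : (A `&` B) x by []; rewrite AB0.
- exact: measurableU.
Qed.

Lemma acharge0 : m set0 = 0%E.
Proof.
rewrite -[LHS]fineK ?acharge_fin //.
by have /= -> := additive_on0 _ _ _ _ measurable0 acharge_additive_on.
Qed.

Lemma abs_acharge A : measurable A -> (`|m A|)%E = `|fine (m A)|%:E.
Proof. by move=> mA; rewrite -[in LHS](fineK (acharge_fin A mA)). Qed.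

(** The variation is a supremum over partitions of all of [A]. A disjoint family inside [A] becomes
    one by adding the remainder as a last piece, whose contribution is nonnegative. *)
Lemma sum_le_variation (I : finType) (P : I -> set T) A :
  measurable A -> (forall i, measurable (P i)) -> trivIset setT P ->
  (forall i, P i `<=` A) ->
  ((\sum_i `|fine (m (P i))|)%:E <= variation_measure m A)%E.
Proof.
move=> mA mP /trivIsetP tP PA.
pose Q (j : 'I_#|I|.+1) : set T :=
  if unlift ord_max j is Some i then P (enum_val i) else A `\` \bigcup_i P i.
have mU : measurable (\bigcup_i P i).
  by apply: fin_bigcup_measurable => //; exact: finite_finset.
have le : ((\sum_i `|fine (m (P i))|)%:E <=
    \sum_(j < #|I|.+1) `|m (Q j)|)%E.
  rewrite big_ord_recr /= -sumEFin.
  rewrite (reindex_onto enum_val enum_rank) /=; last first.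
    by move=> i _; exact: enum_rankK.
  rewrite (eq_bigl xpredT); last by move=> i; rewrite enum_valK eqxx.
  rewrite -[leLHS]adde0 leeD ?abse_ge0 // lee_sum // => i _.
  rewrite /Q (_ : widen_ord _ i = lift ord_max i); last first.
    by apply: val_inj; exact: esym (lift_max i).
  by rewrite liftK abs_acharge.
apply: le_trans le _; apply: ereal_sup_ubound; exists #|I|.+1, Q; split => //.
- by move=> j; rewrite /Q; case: unlift => [i //|]; exact: measurableD.
- apply/trivIsetP => j k _ _; rewrite /Q.
  case: unliftP => [i ->|->]; case: unliftP => [i' ->|->] //.
  + by move=> ii'; apply: tP => //; apply: contraNneq ii' => /enum_val_inj ->.
  + by move=> _; rewrite -subset0 => x [Px [_ []]]; exists (enum_val i).
  + by move=> _; rewrite -subset0 => x [[_ nx] Px]; apply: nx; exists (enum_val i').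
  + by rewrite eqxx.
- apply/seteqP; split=> [x [j _]|x Ax].
    by rewrite /Q; case: unlift => [i|[]//]; exact: PA.
  have [[i _ Px]|nx] := pselect ((\bigcup_i P i) x).
    by exists (lift ord_max (enum_rank i)) => //; rewrite /Q liftK enum_rankK.
  by exists ord_max => //; rewrite /Q unlift_none.
Qed.

Lemma variation_measure_ge0 A : measurable A -> (0 <= variation_measure m A)%E.
Proof.
move=> mA; have := sum_le_variation 'I_0 (fun=> set0) A mA.
by rewrite big_ord0; apply => [[]|[]|[]].
Qed.

Lemma variation_measure_le A B : measurable A -> measurable B -> A `<=` B ->
  (variation_measure m A <= variation_measure m B)%E.
Proof.
move=> mA mB AB; apply: ge_ereal_sup => _ [k [P [mP tP PA ->]]].
under eq_bigr do rewrite abs_acharge //.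
rewrite sumEFin; apply: sum_le_variation => // i.
by apply: subset_trans AB; rewrite -PA; exact: bigcup_sup.
Qed.

Lemma abs_le_variation A B : measurable A -> measurable B -> A `<=` B ->
  (`|fine (m A)|%:E <= variation_measure m B)%E.
Proof.
move=> mA mB AB; have := sum_le_variation unit (fun=> A) B mB.
rewrite big_const card_unit /= addr0; apply => //.
by move=> [] [].
Qed.

Lemma variation_measure_null A : measurable A ->
  (forall B, measurable B -> B `<=` A -> m B = 0%E) ->
  variation_measure m A = 0%E.
Proof.
move=> mA mA0; apply/eqP; rewrite eq_le variation_measure_ge0 // andbT.
apply: ge_ereal_sup => _ [k [P [mP tP PA ->]]].
rewrite big1 // => i _; rewrite mA0 ?abse0 //.
by rewrite -PA; exact: bigcup_sup.
Qed.

(** Cutting every piece of a partition of [A] down to [D] leaves its value under [m] unchanged. *)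
Lemma variation_measure_carried D A : measurable D -> measurable A ->
  carried_by m D -> variation_measure m A = variation_measure m (A `&` D).
Proof.
move=> mD mA mcD; apply/eqP; rewrite eq_le andbC variation_measure_le //=; last first.
  exact: measurableI.
apply: ge_ereal_sup => _ [k [P [mP tP PA ->]]].
have mPD i : measurable (P i `&` D) by exact: measurableI.
under eq_bigr do rewrite mcD // abs_acharge //.
rewrite sumEFin; apply: sum_le_variation => //.
- exact: measurableI.
- exact: trivIset_setIr.
- by move=> i; apply: setSI; rewrite -PA; exact: bigcup_sup.
Qed.

Hypothesis finV : (variation_measure m setT < +oo)%E.

Lemma variation_measure_fin A : measurable A -> variation_measure m A \is a fin_num.
Proof.
move=> mA; rewrite ge0_fin_numE ?variation_measure_ge0 //.
by apply: le_lt_trans finV; exact: variation_measure_le.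
Qed.

(** For one inequality, each piece of a partition of the union is cut along [A] and [B]. For the
    other, a partition of [A] and one of [B] are joined, indexed by the sum of the two index
    types. *)
Lemma variation_measureU A B : measurable A -> measurable B -> A `&` B = set0 ->
  variation_measure m (A `|` B) =
  (variation_measure m A + variation_measure m B)%E.
Proof.
move=> mA mB AB0; have mAB := measurableU _ _ mA mB.
apply/eqP; rewrite eq_le; apply/andP; split.
  apply: ge_ereal_sup => _ [k [P [mP tP PAB ->]]].
  under eq_bigr do rewrite abs_acharge //.
  rewrite sumEFin.
  apply: (@le_trans _ _ ((\sum_i `|fine (m (P i `&` A))|)%:E +
     (\sum_i `|fine (m (P i `&` B))|)%:E)%E).
    rewrite -EFinD lee_fin -big_split /=; apply: ler_sum => i _.
    rewrite -[in leLHS](_ : (P i `&` A) `|` (P i `&` B) = P i); last first.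
      by rewrite -setIUr -PAB; apply: setIidl; exact: bigcup_sup.
    have /= -> := acharge_additive_on (P i `&` A) (P i `&` B).
    - exact: ler_normD.
    - exact: measurableI.
    - exact: measurableI.
    - by rewrite setIACA AB0 setI0.
  apply: leeD; apply: sum_le_variation => // i; try exact: measurableI;
    try exact: trivIset_setIr; exact: subIsetr.
have -> : variation_measure m A = ereal_sup
  [set v | exists (k : nat) (P : 'I_k -> set T),
    [/\ forall i, measurable (P i), trivIset setT P, \bigcup_i P i = A &
        v = (\sum_(i < k) `|m (P i)|)%E]] by [].
(* The two suprema are treated one at a time: the finite term not being bounded is moved to the
   right-hand side. *)
rewrite -leeBrDr ?variation_measure_fin //.
apply: ge_ereal_sup => _ [k [P [mP tP PA ->]]].
under eq_bigr do rewrite abs_acharge //.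
rewrite sumEFin leeBrDr ?variation_measure_fin // addeC -leeBrDr //.
apply: ge_ereal_sup => _ [l [Q [mQ tQ QB ->]]].
under eq_bigr do rewrite abs_acharge //.
rewrite sumEFin leeBrDr // addeC -EFinD.
pose S (i : 'I_k + 'I_l) := match i with inl i => P i | inr j => Q j end.
have PB i : P i `<=` A by rewrite -PA; exact: bigcup_sup.
have QA i : Q i `<=` B by rewrite -QB; exact: bigcup_sup.
have := sum_le_variation _ S (A `|` B) mAB; rewrite big_sumType /=; apply.
- by case.
- move/trivIsetP: tP => tP; move/trivIsetP: tQ => tQ.
  apply/trivIsetP => -[i|i] [j|j] _ _ ij /=.
  + by apply: tP => //; apply: contraNneq ij => ->.
  + by rewrite -subset0 -AB0; apply: setISS.
  + by rewrite -subset0 -AB0 setIC; apply: setISS.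
  + by apply: tQ => //; apply: contraNneq ij => ->.
- by move=> [i|i] x /=; [move/PB; left|move/QA; right].
Qed.

Lemma variation_measure_additive_on :
  additive_on measurable (fine \o variation_measure m).
Proof.
by move=> A B mA mB AB0 /=; rewrite variation_measureU // fineD // variation_measure_fin.
Qed.

Lemma variation_measure0 : variation_measure m set0 = 0%E.
Proof. by apply: variation_measure_null => // B _; rewrite subset0 => ->; exact: acharge0. Qed.

End variation.

(** * Integrals of simple functions over finite partitions *)

Section simple_integral.
Context {d : measure_display} {T : measurableType d} {R : realType}.

Lemma sintegral_partition (m : set T -> \bar R) (I : finType) (r : T -> I)
    (G : I -> R) :
  (forall A, measurable A -> m A \is a fin_num) ->
  additive_on measurable (fine \o m) ->
  (forall i, measurable (r @^-1` [set i])) ->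
  sintegral m (fun x => G (r x)) =
  (\sum_i G i * fine (m (r @^-1` [set i])))%:E.
Proof.
move=> finm addm mr.
pose f x := G (r x).
have m0 : m set0 = 0%E.
  rewrite -[LHS]fineK ?finm //.
  by have /= -> := additive_on0 _ _ _ _ measurable0 addm.
have mf c : m (f @^-1` [set c]) =
    (\sum_i if G i == c then fine (m (r @^-1` [set i])) else 0)%:E.
  pose P i := if G i == c then r @^-1` [set i] else set0.
  have mP i : measurable (P i) by rewrite /P; case: ifP.
  have -> : f @^-1` [set c] = \bigcup_i P i.
    apply/seteqP; split=> [x fxc|x [i _]].
      by exists (r x) => //; rewrite /P (fxc : G (r x) = c) eqxx.
    by rewrite /P; case: eqP => // <- <-.
  rewrite -[LHS]fineK; last first.
    by apply: finm; apply: fin_bigcup_measurable => //; exact: finite_finset.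
  congr EFin.
  have /= -> := additive_on_bigcup _ _ _ (fine \o m) _ P measurable0
    (@measurableU _ _) addm mP.
    by apply: eq_bigr => i _; rewrite /P; case: ifP => //; rewrite m0.
  apply/trivIsetP => i j _ _ ij; rewrite /P -subset0 => x.
  case: ifP => _; case: ifP => _ // -[] //=.
  by move=> ri rj; move: ij; rewrite -ri -rj eqxx.
(* The sum over all reals is cut down to the values of [G], each listed once; any other real has an
   empty level set. *)
pose s := undup (map G (enum I)).
rewrite /sintegral -(fsbig_widen [set` s] setT) //=; last first.
  move=> c [_ /= ncs]; rewrite -/f mf big1 ?mule0 // => i _.
  case: eqP => // Gi; case: ncs.
  by rewrite mem_undup; apply/mapP; exists i; rewrite ?mem_enum.
rewrite -fsbig_seq ?undup_uniq //.
under eq_bigr => c _ do rewrite -/f mf -EFinM mulr_sumr.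
rewrite sumEFin exchange_big /=; congr EFin; apply: eq_bigr => i _.
rewrite (bigD1_seq (G i)) ?undup_uniq //=; last first.
  by rewrite mem_undup; apply/mapP; exists i; rewrite ?mem_enum.
rewrite eqxx big1 ?addr0 // => c /negbTE; rewrite eq_sym => ->.
by rewrite mulr0.
Qed.

Import HBSimple.

(** The cell of [x] is the position of [s x] in a list of the finitely many values. *)
Lemma sfun_partition (s : {sfun T >-> R}) :
  exists (N : nat) (r : T -> 'I_N) (G : 'I_N -> R),
    (forall i, measurable (r @^-1` [set i])) /\ forall x, s x = G (r x).
Proof.
have /finite_seqP[l sl] := @fimfunP _ _ s.
have sxl x : s x \in l.
  by have : [set` l] (s x) by rewrite -sl; exists x.
have idx x : (index (s x) l < size l)%N by rewrite index_mem.
exists (size l), (fun x => Ordinal (idx x)), (fun i => nth 0 l i).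
split=> [i|x]; last by rewrite nth_index.
(* The list may repeat a value; a position other than the first occurrence has an empty cell. *)
have -> : (fun x => Ordinal (idx x)) @^-1` [set i] =
    if index (nth 0 l i) l == i then s @^-1` [set nth 0 l i] else set0.
  apply/seteqP; split=> [x /= <- /=|x].
    by rewrite nth_index // eqxx.
  by case: eqP => //= il sx; apply: val_inj; rewrite /= sx.
by case: ifP => // _; apply: measurable_funPTI; exact: measurable_set1.
Qed.

Lemma measurable_partition_set (I : finType) (r : T -> I) (P : pred I) :
  (forall i, measurable (r @^-1` [set i])) -> measurable [set x | P (r x)].
Proof.
move=> mr; rewrite (_ : [set x | _] = \bigcup_(i in [set` P]) r @^-1` [set i]).
  by apply: fin_bigcup_measurable => //; exact: finite_finset.
by apply/seteqP; split=> [x Px|x [i /= Pi ->]//]; exists (r x).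
Qed.

Lemma pair_partition (I J : finType) (r : T -> I) (q : T -> J) :
  (forall i, measurable (r @^-1` [set i])) ->
  (forall j, measurable (q @^-1` [set j])) ->
  forall k, measurable ((fun x => (r x, q x)) @^-1` [set k]).
Proof.
move=> mr mq [i j]; rewrite (_ : _ @^-1` _ = r @^-1` [set i] `&` q @^-1` [set j]).
  exact: measurableI.
by apply/seteqP; split=> [x [<- <-]|x [/= <- <-]].
Qed.

End simple_integral.

(** * Integrals of uniform limits of simple functions *)

Section integral_of_uniform_limits.
Import HBSimple.
Context {d : measure_display} {T : measurableType d} {R : realType}.
Variable m : {additive_charge set T -> \bar R}.
Hypothesis finV : (variation_measure m setT < +oo)%E.
Implicit Types s t u : {sfun T >-> R}.

Local Notation V := (variation_measure m).
Local Notation W := (fine (V setT)).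

Lemma mass_ge0 : 0 <= W.
Proof. by apply: fine_ge0; exact: variation_measure_ge0. Qed.

Lemma sum_variation_partition (I : finType) (r : T -> I) (P : pred I) :
  (forall i, measurable (r @^-1` [set i])) ->
  \sum_(i | P i) fine (V (r @^-1` [set i])) = fine (V [set x | P (r x)]).
Proof.
move=> mr; pose Q i := if P i then r @^-1` [set i] else set0.
have -> : [set x | P (r x)] = \bigcup_i Q i.
  apply/seteqP; split=> [x Px|x [i _]]; last first.
    by rewrite /Q; case: ifP => // Pi /= ->.
  by exists (r x) => //; rewrite /Q (Px : P (r x)).
have mQ i : measurable (Q i) by rewrite /Q; case: ifP.
have tQ : trivIset setT Q.
  apply/trivIsetP => i j _ _ ij; rewrite /Q -subset0 => x.
  case: ifP => _; case: ifP => _ // -[] //=.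
  by move=> ri rj; move: ij; rewrite -ri -rj eqxx.
have /= -> := additive_on_bigcup _ _ _ (fine \o V) _ Q measurable0
  (@measurableU _ _) (variation_measure_additive_on m finV) mQ tQ.
rewrite big_mkcond /=; apply: eq_bigr => i _; rewrite /Q.
by case: ifP => // _; rewrite variation_measure0.
Qed.

Lemma sum_variation_partitionT (I : finType) (r : T -> I) :
  (forall i, measurable (r @^-1` [set i])) ->
  \sum_i fine (V (r @^-1` [set i])) = W.
Proof.
move=> mr; rewrite (sum_variation_partition _ r xpredT) //.
by congr (fine (V _)); apply/seteqP; split.
Qed.

Lemma sintegral_fin s : sintegral m s \is a fin_num.
Proof.
have [N [r [G [mr sE]]]] := sfun_partition s.
have -> : (s : T -> R) = (fun x => G (r x)) by apply/funext.
by rewrite sintegral_partition //; [exact: acharge_fin|exact: acharge_additive_on].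
Qed.

Lemma sintegral_variation_le s t c : 0 <= c ->
  (forall x, `|s x - t x| <= c) ->
  (sintegral V (fun x => `|s x - t x|%R) <= (c * W)%:E)%E.
Proof.
move=> c0 stc.
have [N [r [G [mr sE]]]] := sfun_partition s.
have [M [q [H [mq tE]]]] := sfun_partition t.
have mrq := pair_partition _ _ r q mr mq.
have -> : (fun x => `|s x - t x|) =
    (fun x => (fun k => `|G k.1 - H k.2|) (r x, q x)).
  by apply/funext => x; rewrite /= sE tE.
rewrite (sintegral_partition V _ (fun x => (r x, q x))
  (fun k => `|G k.1 - H k.2|)) //.
- rewrite lee_fin.
  apply: (@le_trans _ _ (\sum_k c * fine (V ((fun x => (r x, q x)) @^-1` [set k])))).
    apply: ler_sum => k _.
    (* The bound [c] is known only at points, hence on nonempty cells; an empty cell has variation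
       0. *)
    have [[x /= xk]|nx] := pselect (exists x, (r x, q x) = k).
      apply: ler_wpM2r; first by apply: fine_ge0; exact: variation_measure_ge0.
      by rewrite -xk /= -sE -tE.
    rewrite (_ : _ @^-1` _ = set0) ?variation_measure0 /= ?mulr0 //.
    by rewrite -subset0 => x xk; apply: nx; exists x.
  by rewrite -mulr_sumr sum_variation_partitionT.
- by move=> A mA; exact: variation_measure_fin.
- exact: variation_measure_additive_on.
Qed.

(** On a common partition this is the triangle inequality, with the value of [m] on each cell
    bounded by its variation. *)
Lemma sintegral_dist_le s t :
  (`|fine (sintegral m s) - fine (sintegral m t)|%:E <=
   sintegral V (fun x => `|s x - t x|%R))%E.
Proof.
have [N [r [G [mr sE]]]] := sfun_partition s.
have [M [q [H [mq tE]]]] := sfun_partition t.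
have mrq := pair_partition _ _ r q mr mq.
have -> : (s : T -> R) = (fun x => (fun k => G k.1) (r x, q x)).
  by apply/funext => x; rewrite /= sE.
have -> : (t : T -> R) = (fun x => (fun k => H k.2) (r x, q x)).
  by apply/funext => x; rewrite /= tE.
rewrite (sintegral_partition V _ (fun x => (r x, q x))
  (fun k => `|G k.1 - H k.2|)) //; last exact: variation_measure_additive_on;
  last by move=> A mA; exact: variation_measure_fin.
rewrite (sintegral_partition m _ (fun x => (r x, q x)) (fun k => G k.1)) //;
  last exact: acharge_additive_on; last exact: acharge_fin.
rewrite (sintegral_partition m _ (fun x => (r x, q x)) (fun k => H k.2)) //;
  last exact: acharge_additive_on; last exact: acharge_fin.
rewrite lee_fin /= -sumrB; apply: le_trans (ler_norm_sum _ _ _) _.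
apply: ler_sum => k _; rewrite -mulrBl normrM ler_wpM2l //.
rewrite -lee_fin fineK ?variation_measure_fin //.
exact: abs_le_variation.
Qed.

(** Where [s] and [t] differ by at most [eta], the second term suffices; elsewhere [t] is replaced
    by [u] at a cost of at most [c]. No bound on [s] enters, so the estimate applies along sequences
    that are not uniformly bounded. *)
Lemma sintegral_variation_split s t u (c eta : R) : 0 <= eta ->
  (forall x, `|t x| + `|u x| <= c) ->
  (sintegral V (fun x => `|s x - t x|%R) <=
   sintegral V (fun x => `|s x - u x|%R) + (eta * W)%:E +
   (c * fine (V [set x | eta < `|s x - t x|]))%:E)%E.
Proof.
move=> eta0 tuc.
have [N [r [G [mr sE]]]] := sfun_partition s.
have [M [q [H [mq tE]]]] := sfun_partition t.
have [L [p [K [mp uE]]]] := sfun_partition u.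
pose w x := (r x, (q x, p x)).
have mw := pair_partition _ _ r _ mr (pair_partition _ _ q p mq mp).
have -> : (fun x => `|s x - t x|) = (fun x => (fun k => `|G k.1 - H k.2.1|) (w x)).
  by apply/funext => x; rewrite /= sE tE.
have -> : (fun x => `|s x - u x|) = (fun x => (fun k => `|G k.1 - K k.2.2|) (w x)).
  by apply/funext => x; rewrite /= sE uE.
have finV' A : measurable A -> V A \is a fin_num by exact: variation_measure_fin.
have addV := variation_measure_additive_on m finV.
rewrite (sintegral_partition V _ w (fun k => `|G k.1 - H k.2.1|)) //.
rewrite (sintegral_partition V _ w (fun k => `|G k.1 - K k.2.2|)) //.
have -> : [set x | eta < `|s x - t x|] = [set x | eta < `|G (w x).1 - H (w x).2.1|].
  by apply/funext => x; rewrite /= sE tE.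
rewrite -(sum_variation_partition _ w (fun k => eta < `|G k.1 - H k.2.1|)) //.
rewrite -(sum_variation_partitionT _ w) //.
rewrite -!EFinD lee_fin [X in _ + c * X]big_mkcond !mulr_sumr -!big_split /=.
apply: ler_sum => k _.
set v := fine _.
have v0 : 0 <= v by apply: fine_ge0; exact: variation_measure_ge0.
have [[x xk]|nx] := pselect (exists x, w x = k); last first.
  rewrite /v (_ : _ @^-1` _ = set0) ?variation_measure0 ?mulr0 ?addr0 ?add0r //=.
    by case: ifP => _ ; rewrite mulr0.
  by rewrite -subset0 => x xk; apply: nx; exists x.
have := tuc x; rewrite tE uE.
have -> : H (q x) = H k.2.1 by rewrite -xk.
have -> : K (p x) = K k.2.2 by rewrite -xk.
set a := G _; set b := H _; set e := K _ => bec.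
case: ltP => ab.
  have le : `|a - b| <= `|a - e| + c.
    rewrite -[a - b](subrKA e) (le_trans (ler_normD _ _)) // lerD2l.
    by rewrite (le_trans (ler_normB _ _)) // addrC.
  rewrite -addrA [eta * v + _]addrC addrA -mulrDl.
  by rewrite (le_trans (ler_wpM2r v0 le)) // lerDl mulr_ge0.
rewrite mulr0 addr0 (le_trans (ler_wpM2r v0 ab)) // lerDr mulr_ge0 //.
Qed.

Lemma sfun_bounded s : exists2 c : R, 0 <= c & forall x, `|s x| <= c.
Proof.
have [N [r [G [mr sE]]]] := sfun_partition s.
exists (\sum_i `|G i|); first exact: sumr_ge0.
by move=> x; rewrite sE (bigD1 (r x)) //= lerDl sumr_ge0.
Qed.

(** Existence comes from a uniformly convergent sequence. For an arbitrary approximating sequence,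
    its late members are compared with one uniform approximation [t], whose integral is already
    known to be close to [I]. *)
Lemma is_integral_uniform (D : set T) (f : T -> R) (I : R) :
  measurable D -> carried_by m D ->
  (forall eta, 0 < eta -> exists t, forall x, `|t x - f x| <= eta) ->
  (forall eta t, 0 < eta -> (forall x, `|t x - f x| <= eta) ->
    `|fine (sintegral m t) - I| <= eta * W) ->
  is_integral m D f I.
Proof.
move=> mD mcD fapp fI.
have outer_ge0 B : (0 <= outer_set_function V D B)%E.
  by apply: le_ereal_inf_tmp => _ [A [mA _ _] <-]; exact: variation_measure_ge0.
split.
  have [t tf] : {t : nat -> {sfun T >-> R} &
      forall k x, `|t k x - f x| <= k.+1%:R^-1}.
    apply: (@boolp.choice _ _ (fun k t => forall x, `|t x - f x| <= k.+1%:R^-1)) => k.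
    by apply: fapp; rewrite invr_gt0.
  have small (e : R) : 0 < e -> \forall k \near \oo, k.+1%:R^-1 < e.
    move=> e0; have := @cvg_harmonic R => /cvgrPdist_lt /(_ _ e0).
    by apply: filterS => k /=; rewrite sub0r normrN ger0_norm.
  exists t; split=> e e0.
    (* Once [k.+1%:R^-1] drops below [e], the exceptional set is empty. *)
    apply: cvg_near_cst; near=> k.
    rewrite (_ : D `&` _ = set0).
      apply/eqP; rewrite eq_le outer_ge0 andbT.
      by apply: ereal_inf_lbound; exists set0; [split|rewrite variation_measure0].
    rewrite -subset0 => x [_ /=]; apply/negP; rewrite -leNgt.
    apply: le_trans (tf k x) _; apply/ltW; near: k; exact: small.
  (* The 2 accounts for the two approximations [t k] and [t l]; [W + 1] replaces [W], which may be
     0. *)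
  have e'0 : 0 < e / (2 * (W + 1)).
    by rewrite divr_gt0 // mulr_gt0 // ltr_wpDl // mass_ge0.
  have [N _ Ne] := small _ e'0.
  exists ([set k | (N <= k)%N], [set k | (N <= k)%N]).
    by split; exists N.
  move=> [k l] [/= Nk Nl].
  apply: le_lt_trans (sintegral_variation_le _ _ (e / (W + 1)) _ _) _.
  - by rewrite divr_ge0 ?ltW // ltr_wpDl // mass_ge0.
  - move=> x; rewrite -[t k x - t l x](subrKA (f x)).
    rewrite (le_trans (ler_normD _ _)) // [`|f x - _|]distrC.
    have -> : e / (W + 1) = e / (2 * (W + 1)) + e / (2 * (W + 1)).
      by field; rewrite gt_eqF // ltr_wpDl // mass_ge0.
    by apply: lerD; apply: le_trans (tf _ x) _; apply/ltW; exact: Ne.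
  - rewrite lte_fin mulrAC ltr_pdivrMr ?ltr_wpDl ?mass_ge0 //.
    by rewrite ltr_pM2l // ltrDl.
move=> s [sf sC].
rewrite (_ : (fun k => _) = EFin \o (fun k => fine (sintegral m (s k)))); last first.
  by apply/funext => k /=; rewrite fineK // sintegral_fin.
apply: cvg_EFin; first by apply: nearW => k.
apply/cvgrPdist_le => e e0 /=.
have W0 := mass_ge0.
(* The error [eta * W] occurs three times, twice through the threshold [2 * eta] and once between
   [t] and [I], for a total of at most [e / 2]. The Cauchy term and the exceptional set get [e / 4]
   each. *)
pose eta := e / (6 * (W + 1)).
have eta0 : 0 < eta by rewrite divr_gt0 // mulr_gt0 // ltr_wpDl.
have [t tf] := fapp _ eta0.
have e4 : 0 < e / 4 by rewrite divr_gt0.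
have [[A B] [[a _ Aa] [b _ Bb]] AB] := sC _ e4.
(* [s N] plays the part of [u] in [sintegral_variation_split]: it is bounded, and the integral of
   its distance to any later [s k] is below [e / 4]. *)
pose N := maxn a b.
have [ct ct0 tct] := sfun_bounded t.
have [cu cu0 ucu] := sfun_bounded (s N).
pose c := ct + cu.
have c0 : 0 <= c by exact: addr_ge0.
have e'0 : 0 < e / (4 * (c + 1)) by rewrite divr_gt0 // mulr_gt0 // ltr_wpDl.
have [ofin] := (fine_cvgP _ 0).1 (sf _ eta0).
move=> /cvgrPdist_lt /(_ _ e'0) onear.
near=> k.
have kN : (N <= k)%N by near: k; exact: nbhs_infty_ge.
have IsN : (sintegral V (fun x => `|s k x - s N x|%R) < (e / 4)%:E)%E.
  by apply: (AB (k, N)); split=> /=; [apply: Aa|apply: Bb];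
    rewrite /= ?(leq_trans _ kN) ?leq_maxl ?leq_maxr.
have finO : outer_set_function V D
  (D `&` [set x | eta < `|s k x - f x|]) \is a fin_num by near: k.
have Ole : `|0 - fine (outer_set_function V D
  (D `&` [set x | eta < `|s k x - f x|]))| < e / (4 * (c + 1)) by near: k.
move: finO Ole; set O := outer_set_function V D _ => finO.
rewrite sub0r normrN ger0_norm ?fine_ge0 ?outer_ge0 // => Ole.
have mE : measurable [set x | 2 * eta < `|s k x - t x|].
  have [n [r [G [mr sE]]]] := sfun_partition (s k).
  have [l [q [H [mq tE]]]] := sfun_partition t.
  have -> : [set x | 2 * eta < `|s k x - t x|] = [set x |
      (fun p => 2 * eta < `|G p.1 - H p.2|) (r x, q x)].
    by apply/funext => x; rewrite /= sE tE.
  apply: (measurable_partition_set _ (fun x => (r x, q x))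
    (fun p => 2 * eta < `|G p.1 - H p.2|)).
  exact: pair_partition.
(* Since [t] is within [eta] of [f], a point of [D] where [s k] is more than [2 * eta] from [t] lies
   in the exceptional set of [f]; points outside [D] do not count because [D] carries [m]. *)
have VE : fine (V [set x | 2 * eta < `|s k x - t x|]) <= fine O.
  apply: fine_le => //; first exact: variation_measure_fin.
  rewrite (variation_measure_carried m D) //.
  apply: le_ereal_inf_tmp => _ [A' [mA' A'D sub] <-].
  apply: variation_measure_le => //; first exact: measurableI.
  move=> x [/= xE Dx]; apply: sub; split=> //=.
  have : `|s k x - t x| <= `|s k x - f x| + `|t x - f x|.
    by rewrite -[s k x - t x](subrKA (f x)) [`|t x - _|]distrC ler_normD.
  by have := tf x; lra.
have sle : (sintegral V (fun x => `|s k x - t x|%R) <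
    (e / 4 + 2 * eta * W + c * fine O)%:E)%E.
  apply: le_lt_trans (sintegral_variation_split (s k) t (s N) c (2 * eta) _ _) _.
  - by rewrite mulr_ge0 // ltW.
  - by move=> x; exact: lerD.
  - rewrite !EFinD; apply: lte_leD; rewrite ?lee_fin ?fin_numM //.
      by rewrite lteD2rE.
    exact: ler_wpM2l.
have dist : `|fine (sintegral m (s k)) - fine (sintegral m t)| <
    e / 4 + 2 * eta * W + c * fine O.
  by rewrite -lte_fin; apply: le_lt_trans (sintegral_dist_le _ _) _.
have Idist := fI _ _ eta0 tf.
have etaW : 6 * (eta * W) <= e.
  have -> : 6 * (eta * W) = e * (W / (W + 1)).
    by rewrite /eta; field; rewrite gt_eqF // ltr_wpDl.
  apply: ler_piMr; first exact: ltW.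
  by rewrite ler_pdivrMr ?ltr_wpDl // mul1r lerDl.
have cO : 4 * (c * fine O) <= e.
  have c1 : 0 < c + 1 by rewrite ltr_wpDl.
  have : c * fine O <= (c + 1) * (e / (4 * (c + 1))).
    by apply: ler_pM => //; rewrite ?fine_ge0 ?outer_ge0 ?lerDl // ltW.
  have -> : (c + 1) * (e / (4 * (c + 1))) = e / 4 by field; rewrite gt_eqF.
  lra.
have : `|I - fine (sintegral m (s k))| <=
  `|fine (sintegral m (s k)) - fine (sintegral m t)| +
  `|fine (sintegral m t) - I|.
  rewrite distrC -[fine _ - I](subrKA (fine (sintegral m t))).
  exact: ler_normD.
by lra.
Unshelve. all: end_near. Qed.

(** Each approximation confines the integral to an interval of radius [eta * W]. Every left endpoint
    is below every right endpoint, so the supremum of the left endpoints lies in all the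
    intervals. *)
Lemma exists_uniform_integral (f : T -> R) :
  (forall eta, 0 < eta -> exists t, forall x, `|t x - f x| <= eta) ->
  exists I : R, forall eta t, 0 < eta -> (forall x, `|t x - f x| <= eta) ->
    `|fine (sintegral m t) - I| <= eta * W.
Proof.
move=> fapp.
pose S := [set v | exists eta t, [/\ 0 < eta,
  forall x, `|t x - f x| <= eta & v = fine (sintegral m t) - eta * W]].
have cmp eta t eta' t' : 0 < eta -> 0 < eta' ->
    (forall x, `|t x - f x| <= eta) -> (forall x, `|t' x - f x| <= eta') ->
    fine (sintegral m t) - eta * W <= fine (sintegral m t') + eta' * W.
  move=> eta0 eta'0 tf tf'.
  have : `|fine (sintegral m t) - fine (sintegral m t')| <= (eta + eta') * W.
    rewrite -lee_fin; apply: le_trans (sintegral_dist_le _ _) _.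
    apply: sintegral_variation_le; first by rewrite addr_ge0 // ltW.
    move=> x; rewrite -[t x - t' x](subrKA (f x)).
    by rewrite (le_trans (ler_normD _ _)) // [`|f x - _|]distrC lerD.
  by rewrite ler_norml mulrDl => /andP[_]; lra.
exists (sup S) => eta t eta0 tf.
have St : S (fine (sintegral m t) - eta * W) by exists eta, t.
have Sub : ubound S (fine (sintegral m t) + eta * W).
  by move=> _ [eta' [t' [eta'0 tf' ->]]]; exact: cmp.
have S1 : sup S <= fine (sintegral m t) + eta * W.
  by apply: ge_sup => //; exists (fine (sintegral m t) - eta * W).
have S2 : fine (sintegral m t) - eta * W <= sup S.
  by apply: ub_le_sup => //; exists (fine (sintegral m t) + eta * W).
by rewrite ler_norml; apply/andP; split; lra.
Qed.

End integral_of_uniform_limits.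

(** * Limits along ultrafilters *)

Lemma ultra_fmap (T U : Type) (G : set_system T) (f : T -> U) :
  UltraFilter G -> UltraFilter (f @ G).
Proof.
move=> GU; split=> [|H FH fGH]; first exact: fmap_proper_filter.
apply/seteqP; split=> // A HA.
have [//|GnA] := in_ultra_setVsetC (f @^-1` A) GU.
have : H (A `&` ~` A) by apply: filterI => //; exact: fGH.
by rewrite setICr => /filter_not_empty.
Qed.

(** The image ultrafilter contains a compact segment. *)
Lemma ultra_bounded_cvg (R : realType) (T : Type) (G : set_system T)
    (f : T -> R) (M : R) :
  UltraFilter G -> (\forall p \near G, `|f p| <= M) -> cvg (f @ G).
Proof.
move=> GU fM; have := @segment_compact R (- M) M.
rewrite compact_ultra => /(_ (f @ G) (ultra_fmap _ _ _ f GU)) [].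
  by apply: filterS fM => p; rewrite /= in_itv /= ler_norml.
by move=> l [_ fl]; apply/cvg_ex; exists l.
Qed.

(** * Extension of a finitely additive charge to all subsets *)

Section discrete_extension.
Context {d : measure_display} {T : measurableType d}.

(** Such a [p] moves each point within its cell of the countable partition given by [r]. Preimages
    under [p] are measurable for every subset, and unions of cells are their own preimages. *)
Definition refining (r : T -> nat) : set (T -> T) :=
  [set p | (forall S, measurable (p @^-1` S)) /\ forall x, r (p x) = r x].

Definition refining_filter : set_system (T -> T) :=
  filter_from [set r | forall n : nat, measurable (r @^-1` [set n])] refining.

(** Choosing one representative in each cell gives a refining map, and any two countable measurable
    partitions have a common refinement. *)
Lemma refining_filter_proper : ProperFilter refining_filter.
Proof.
apply: filter_from_proper; last first.
  move=> r mr; have [[x0 _]|T0] := pselect (exists x : T, True).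
    (* The default [x0] is used only for numbers [n] whose cell is empty. As [q \o r] factors
       through the naturals, its preimages are countable unions of cells. *)
    pose q n := xget x0 [set y | r y = n].
    exists (q \o r); split=> [S|x /=]; last first.
      exact: (@xgetPex _ x0 [set y | r y = r x]) (ex_intro _ x erefl).
    rewrite (_ : _ @^-1` _ = \bigcup_(n in q @^-1` S) r @^-1` [set n]).
      exact: bigcup_measurable.
    by apply/seteqP; split=> [x Sx|x [n Sn rxn]]; [exists (r x)|rewrite /= rxn].
  exists id; split=> // S; rewrite (_ : _ @^-1` _ = set0) //.
  by rewrite -subset0 => x _; apply: T0; exists x.
apply: filter_from_filter.
  exists (fun=> 0%N) => n.
  by rewrite preimage_cst; case: ifP.
(* The common refinement is coded by pairs, [pickle] turning a pair into a natural number. *)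
move=> r q mr mq; exists (fun x => pickle (r x, q x)) => [n /=|p [mp rq]].
  have [[x0 <-]|nx] := pselect (exists x, pickle (r x, q x) = n); last first.
    rewrite (_ : _ @^-1` _ = set0) //.
    by rewrite -subset0 => x xn; apply: nx; exists x.
  rewrite (_ : _ @^-1` _ = r @^-1` [set r x0] `&` q @^-1` [set q x0]).
    exact: measurableI.
  apply/seteqP; split=> [x /= /(pcan_inj pickleK)[-> ->] //|x /= [-> ->] //].
by split; split=> // x; have /(pcan_inj pickleK)[] := rq x.
Qed.

Context {R : realType}.
Variable sigma : {additive_charge set T -> \bar R}.
Hypothesis finV : (variation_measure sigma setT < +oo)%E.
Local Notation V := (variation_measure sigma).

(* Each [p] below pushes [sigma] forward to an additive function on all subsets;
   the extension is the limit of these along an ultrafilter. *)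
Lemma additive_extension : exists tau : set T -> R,
  [/\ additive_on setT tau,
      forall B, measurable B -> tau B = fine (sigma B) &
      forall (I : finType) (S : I -> set T) B, measurable B ->
        trivIset setT S -> (forall i, S i `<=` B) ->
        \sum_i `|tau (S i)| <= fine (V B)].
Proof.
have [G [GU fG]] := ultraFilterLemma refining_filter_proper.
pose f S (p : T -> T) := fine (sigma (p @^-1` S)).
have Gr r : (forall n : nat, measurable (r @^-1` [set n])) ->
  \forall p \near G, refining r p by move=> mr; apply: fG; exists r.
have Gm : \forall p \near G, forall S, measurable (p @^-1` S).
  have : \forall p \near G, refining (fun=> 0%N) p.
    by apply: Gr => n; rewrite preimage_cst; case: ifP.
  by apply: filterS => p [].
(* A measurable set is its own preimage as soon as [p] respects the partition into [B] and its
   complement; hence the limit extends [sigma]. *)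
have GB B : measurable B -> \forall p \near G, p @^-1` B = B.
  move=> mB; have : \forall p \near G, refining (fun x => `[< B x >] : nat) p.
    apply: Gr => n; case: n => [|[|n]].
    - rewrite (_ : _ @^-1` _ = ~` B); first exact: measurableC.
      by apply/seteqP; split=> x /=; case: asboolP.
    - rewrite (_ : _ @^-1` _ = B) //.
      by apply/seteqP; split=> x /=; case: asboolP.
    - rewrite (_ : _ @^-1` _ = set0) //.
      by rewrite -subset0 => x /=; case: asboolP.
  apply: filterS => p [_ rp]; apply/seteqP; split=> x; have := rp x => /=;
    by case: asboolP => ?; case: asboolP.
have fV S B : measurable B -> S `<=` B ->
    \forall p \near G, `|f S p| <= fine (V B).
  move=> mB SB; apply: filterS2 Gm (GB _ mB) => p mp pB.
  rewrite -lee_fin fineK ?variation_measure_fin //.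
  by apply: abs_le_variation => // x Sx; rewrite -pB; exact: SB.
(* The variation over the whole space bounds [f S], so every set has a limit. *)
have fcvg S : f S @ G --> lim (f S @ G).
  by apply: ultra_bounded_cvg; apply: (fV S setT).
exists (fun S => lim (f S @ G)); split.
- move=> A B _ _ AB0; apply: norm_cvg_lim.
  apply: cvg_trans (cvgD (fcvg A) (fcvg B)); apply: near_eq_cvg.
  apply: filterS Gm => p mp.
  rewrite /f preimage_setU.
  have /= -> // := acharge_additive_on sigma (p @^-1` A) (p @^-1` B).
  by rewrite -preimage_setI AB0 preimage_set0.
- move=> B mB; apply: norm_lim_near_cst.
  by apply: filterS (GB _ mB) => p pB; rewrite /f pB.
- move=> I S B mB tS SB.
  (* For each late [p] the preimages of the [S i] are disjoint measurable subsets of [B], so the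
     bound holds before the limit. *)
  have : \sum_i `|f (S i) p| @[p --> G] --> \sum_i `|lim (f (S i) @ G)|.
    elim: (index_enum I) => [|i s IH].
      rewrite big_nil; under eq_fun do rewrite big_nil; exact: cvg_cst.
    rewrite big_cons; under eq_fun do rewrite big_cons.
    by apply: cvgD => //; exact: (cvg_norm (fcvg (S i))).
  move=> /cvgr_to_le; apply.
  apply: filterS2 Gm (GB _ mB) => p mp pB.
  rewrite -lee_fin fineK ?variation_measure_fin //.
  apply: sum_le_variation => // [|i].
    move/trivIsetP : tS => tS; apply/trivIsetP => i j _ _ ij.
    by rewrite -preimage_setI tS // preimage_set0.
  by move=> x Sx; rewrite -pB; exact: (SB i (p x)).
Qed.

End discrete_extension.

(** * The ideal of Lebesgue null sets *)

Section lebesgue_null.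
Context {R : realType} {n : nat}.
Implicit Types A B : set 'rV[R]_n.

Lemma box_volume_ge0 (a b : 'rV[R]_n) : (0 <= (box_volume a b)%:E)%E.
Proof. by rewrite lee_fin prodr_ge0 // => i _; rewrite le_max lexx. Qed.

Lemma lebesgue_Rn_ge0 A : (0 <= lebesgue_Rn A)%E.
Proof.
apply: le_ereal_inf_tmp => _ [J [a [b [_ ->]]]].
by apply: esum_ge0 => k _; exact: box_volume_ge0.
Qed.

Lemma lebesgue_Rn_le A B : A `<=` B -> (lebesgue_Rn A <= lebesgue_Rn B)%E.
Proof.
move=> AB; apply: ereal_inf_le_tmp => _ [J [a [b [BJ ->]]]].
by exists J, a, b; split => //; exact: subset_trans BJ.
Qed.

Lemma lebesgue_Rn_null_sub A B :
  A `<=` B -> lebesgue_Rn B = 0%E -> lebesgue_Rn A = 0%E.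
Proof.
move=> AB B0; apply/eqP.
by rewrite eq_le lebesgue_Rn_ge0 andbT -B0 lebesgue_Rn_le.
Qed.

Lemma lebesgue_Rn_cover_lt A (e : R) : lebesgue_Rn A = 0%E -> 0 < e ->
  exists (J : set nat) (a b : nat -> 'rV[R]_n),
    A `<=` \bigcup_(k in J) box (a k) (b k) /\
    (\esum_(k in J) (box_volume (a k) (b k))%:E < e%:E)%E.
Proof.
move=> A0 e0; have : (lebesgue_Rn A < e%:E)%E by rewrite A0 lte_fin.
by move=> /ereal_inf_lt[_ [J [a [b [AJ ->]]]] le]; exists J, a, b.
Qed.

(* The two covers are interleaved on the even and the odd indices. *)
Lemma lebesgue_Rn_nullU A B :
  lebesgue_Rn A = 0%E -> lebesgue_Rn B = 0%E -> lebesgue_Rn (A `|` B) = 0%E.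
Proof.
move=> A0 B0; apply/eqP; rewrite eq_le lebesgue_Rn_ge0 andbT.
apply/lee_addgt0Pr => e e0; rewrite add0e.
have e20 : 0 < e / 2 by rewrite divr_gt0.
have [JA [a [b [AJ Ale]]]] := lebesgue_Rn_cover_lt A _ A0 e20.
have [JB [a' [b' [BJ Ble]]]] := lebesgue_Rn_cover_lt B _ B0 e20.
pose c k := if odd k then a' k./2 else a k./2.
pose c' k := if odd k then b' k./2 else b k./2.
pose J := double @` JA `|` (fun k => k.*2.+1) @` JB.
have JO : J `&` [set k | odd k] = (fun k => k.*2.+1) @` JB.
  apply/seteqP; split=> [_ [[[k Jk <-]|//] /=]|_ [k Jk <-]].
    by rewrite odd_double.
  by split; [right; exists k|rewrite /= odd_double].
have JE : J `&` ~` [set k | odd k] = double @` JA.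
  apply/seteqP; split=> [_ [[//|[k Jk <-]] /=]|_ [k Jk <-]].
    by rewrite odd_double.
  by split; [left; exists k|rewrite /= odd_double].
apply: (@le_trans _ _ (\esum_(k in J) (box_volume (c k) (c' k))%:E)).
  apply: ereal_inf_lbound; exists J, c, c'; split => // x [/AJ|/BJ] [k Jk kx].
    exists k.*2; first by left; exists k.
    by rewrite /c /c' odd_double doubleK.
  exists k.*2.+1; first by right; exists k.
  by rewrite /c /c' /= odd_double /= uphalf_double.
have v0 k : (0 <= (box_volume (c k) (c' k))%:E)%E by exact: box_volume_ge0.
rewrite (esumID [set k | odd k]) // JO JE.
rewrite !esum_image; last 2 first.
- by move=> i j _ _; exact: double_inj.
- by move=> i j _ _ [] /double_inj.
rewrite [e]splitr EFinD addeC; apply: leeD; apply/ltW.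
  by under eq_esum do rewrite /c /c' odd_double doubleK.
by under eq_esum do rewrite /c /c' /= odd_double /= uphalf_double.
Qed.

End lebesgue_null.

(** * Ultrafilters at points of positive density *)

Section density_ultrafilter.
Context {R : realType} {n : nat}.
Variable Omega : set 'rV[R]_n.

(** The Euclidean norm dominates the sup norm, so the density hypothesis, stated with Euclidean
    balls, applies to topological neighborhoods. *)
Lemma euclidean_ball_sub (x : 'rV[R]_n) (e : R) :
  0 < e -> euclidean_ball x e `<=` ball x e.
Proof.
move=> e0 y; rewrite /euclidean_ball /euclidean_norm /= => yx.
split=> // i j.
rewrite (ord1 i) /ball /= distrC.
apply: le_lt_trans yx.
rewrite -sqrtr_sqr ler_wsqrtr // (bigD1 j) //= !mxE lerDl.
by apply: sumr_ge0 => k _; exact: sqr_ge0.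
Qed.

Lemma exists_density_ultrafilter (x : 'rV[R]_n) :
  (forall e : R, 0 < e -> (0 < lebesgue_Rn (euclidean_ball x e `&` Omega))%E) ->
  exists U : set_system 'rV[R]_n, [/\ UltraFilter U, U --> x, U Omega &
    forall N, lebesgue_Rn N = 0%E -> U (~` N)].
Proof.
move=> xpos.
pose D := [set VN : set 'rV[R]_n * set 'rV[R]_n |
  nbhs x VN.1 /\ lebesgue_Rn VN.2 = 0%E].
pose B (VN : set 'rV[R]_n * set 'rV[R]_n) := VN.1 `&` Omega `&` ~` VN.2.
(* The cover indexed by the empty set has sum 0 in every dimension, including 0. *)
have L0 : lebesgue_Rn (set0 : set 'rV[R]_n) = 0%E.
  apply/eqP; rewrite eq_le lebesgue_Rn_ge0 andbT.
  apply: ereal_inf_lbound; exists set0, (fun=> 0), (fun=> 0).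
  by rewrite esum_set0; split.
have FF : ProperFilter (filter_from D B).
  apply: filter_from_proper; last first.
    (* If a basic set were empty, the part of [Omega] in a small ball would lie in [N] and be
       null. *)
    move=> [V N] [/= /nbhs_ballP[e /= e0 eV] N0]; apply/set0P/negP => /eqP BE.
    have := xpos _ e0; rewrite (lebesgue_Rn_null_sub _ N) ?ltxx // => y [ye yO].
    apply: contrapT => nNy; have : B (V, N) y.
      by split=> //; split=> //=; apply: eV; exact: euclidean_ball_sub.
    by rewrite BE.
  apply: filter_from_filter.
    by exists (setT, set0); split=> //=; exact: filterT.
  move=> [V N] [V' N'] [/= Vx N0] [/= V'x N'0].
  exists (V `&` V', N `|` N') => [|y [[[Vy V'y] Oy] /= nN]].
    by split=> /=; [exact: filterI|exact: lebesgue_Rn_nullU].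
  by split; split=> //=; apply: contra_not nN => ?; [left|right].
have [U [UU FU]] := ultraFilterLemma FF.
exists U; split=> // [V Vx||N N0].
- by apply: FU; exists (V, set0) => // y [[]].
- by apply: FU; exists (setT, set0) => [|y [[]]//]; split=> //=; exact: filterT.
- by apply: FU; exists (setT, N) => [|y []//]; split=> //=; exact: filterT.
Qed.

End density_ultrafilter.

(** * Uniform approximation of bounded measurable functions *)

Section bounded_functions.
Import HBSimple.

Lemma sfun_uniform_approx (d : measure_display) (T : measurableType d)
    (R : realType) (f : T -> R) (M eta : R) :
  measurable_fun setT f -> (forall x, `|f x| <= M) -> 0 < eta ->
  exists t : {sfun T >-> R}, forall x, `|t x - f x| <= eta.
Proof.
move=> mf fM eta0.
(* Rounding down to a multiple of [eta]; this is monotone, hence Borel. *)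
pose g (z : R) : R := eta * (Num.floor (z / eta))%:~R.
have mg : measurable_fun setT (g \o f).
  apply: measurableT_comp mf; apply: nondecreasing_measurable => // x y xy.
  by rewrite /g ler_pM2l // ler_int le_floor // ler_pM2r // invr_gt0.
have fg : finite_set (range (g \o f)).
  (* The bound [M] confines the rounded quotients to integers from [- N] up to [N - 1]; [h]
     enumerates the corresponding multiples of [eta]. *)
  pose N := Num.bound (`|M| / eta + 1).
  pose h (j : nat) : R := eta * (j%:Z - N%:Z)%:~R.
  apply: (@sub_finite_set _ _ (h @` `I_(N + N))); last exact/finite_image/finite_II.
  move=> _ [x _ <-] /=; set k := Num.floor (f x / eta).
  have /andP[k1 k2] := floor_itv (f x / eta); rewrite -/k in k1 k2.
  have NM : `|f x / eta| + 1 < N%:R.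
    apply: le_lt_trans (archi_boundP _).
      by rewrite lerD2r normrM normfV (gtr0_norm eta0) ler_pM2r ?invr_gt0 //
        (le_trans (fM x)) // ler_norm.
    by rewrite addr_ge0 // divr_ge0 // ltW.
  have [kN1 kN2] : (- N%:Z <= k)%R /\ (k < N%:Z)%R.
    move: (ler_norm (f x / eta)) (ler_norm (- (f x / eta))).
    rewrite normrN => a1 a2; split.
      rewrite -ltzD1 -(ltr_int R) rmorphN /=.
      by apply: le_lt_trans k2; rewrite -[(_ : int)%:~R]/(N%:R : R); lra.
    by rewrite -(ltr_int R); apply: le_lt_trans k1 _; rewrite -[(_ : int)%:~R]/(N%:R : R); lra.
  exists (absz (k + N%:Z)); first by rewrite /=; lia.
  by rewrite /h /g /=; congr (_ * _%:~R); lia.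
have sg : g \o f \in sfun by apply/andP; rewrite !inE.
exists (sfun_Sub sg) => x.
have -> : sfun_Sub sg x = g (f x) by [].
have /andP[k1 k2] := floor_itv (f x / eta).
have fE : f x = eta * (f x / eta) by rewrite mulrC divfK // gt_eqF.
rewrite /g [X in _ - X]fE -mulrBr normrM (gtr0_norm eta0).
apply: ler_piMr; first exact: ltW.
rewrite intrD in k2.
by rewrite ler_norml; apply/andP; split; lra.
Qed.

End bounded_functions.

Lemma measurable_open (R : realType) (n : nat) (A : set 'rV[R]_n) :
  open A -> measurable (A : set (borelRn R n)).
Proof. by move=> oA; exact: sub_sigma_algebra. Qed.

(** * Continuous functions with compact support in [Omega] *)

Section compactly_supported.
Context {R : realType} {n : nat}.
Variables (Omega : set 'rV[R]_n) (phi : 'rV[R]_n -> R).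
Hypothesis phic : continuous_compact_support Omega phi.

Lemma continuous_compact_support_bounded : exists M : R, forall x, `|phi x| <= M.
Proof.
have [cphi phi0 cK] := phic.
set K := _ `&` _ in cK.
have cphiK : {within K, continuous phi}.
  by apply: continuous_subspaceW cphi; exact: subIsetl.
have /compact_bounded[M [_ MB]] := continuous_compact cphiK cK.
exists (Num.max 0 (M + 1)) => x; rewrite le_max.
have [Kx|nKx] := pselect (K x).
  by apply/orP; right; apply: (MB (M + 1)) => /=; [rewrite ltrDl|exists x].
suff -> : phi x = 0 by rewrite normr0 lexx.
have [Ox|] := pselect (Omega x); last exact: phi0.
apply/eqP/negPn/negP => phix; apply: nKx; split=> //.
exact: subset_closure.
Qed.

(** The preimage of an open interval is a relatively open part of [Omega], together with the
    complement of [Omega] when the interval contains 0. *)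
Lemma continuous_compact_support_measurable :
  measurable (Omega : set (borelRn R n)) ->
  measurable_fun setT (phi : borelRn R n -> R).
Proof.
move=> mO; have [cphi phi0 _] := phic.
apply: (measurability _ (RGenOpens.measurableE R)).
move=> _ [_ [a [b ->] <-]]; rewrite setTI; set I := `]a, b[%classic.
have oI : open I by exact: interval_open.
have /open_subspaceP[V oV VI] : open (phi @^-1` I : set (subspace Omega)).
  by move/continuousP : cphi; exact.
have -> : phi @^-1` I = (V `&` Omega) `|` (if `[< I 0 >] then ~` Omega else set0).
  rewrite VI; apply/seteqP; split=> x /=.
    move=> Ix; have [Ox|nOx] := pselect (Omega x); [by left|right].
    by move: Ix; rewrite phi0 // => I0; rewrite asboolT.
  by move=> [[]//|]; case: asboolP => // I0 nOx; rewrite phi0.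
apply: measurableU; first by apply: measurableI => //; exact: measurable_open.
by case: ifP => // _; exact: measurableC.
Qed.

(** At a point of [Omega] this is relative continuity, as [U] contains [Omega]. At any other point
    [phi] is 0, and it vanishes nearby because the complement of its compact support is a
    neighborhood. *)
Lemma continuous_compact_support_cvg (U : set_system 'rV[R]_n) (x : 'rV[R]_n) :
  Filter U -> U --> x -> U Omega ->
  forall e : R, 0 < e -> U [set y | `|phi y - phi x| < e].
Proof.
move=> FU Ux UO e e0; have [cphi phi0 cK] := phic.
have [Ox|nOx] := pselect (Omega x).
  have : nbhs (x : subspace Omega) (phi @^-1` [set z | `|z - phi x| < e]).
    have := cphi x; move=> /(_ [set z | `|z - phi x| < e]); apply.
    apply/nbhs_ballP; exists e => // z /=.
    by rewrite /ball /= distrC.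
  move=> /(nbhs_subspace_ex _ Ox)[V Vx VO].
  apply: filterS (filterI (Ux _ Vx) UO) => y Vy.
  by have [] : (phi @^-1` [set z | `|z - phi x| < e] `&` Omega) y by rewrite VO.
set K := _ `&` _ in cK.
have oK : nbhs x (~` K).
  apply: open_nbhs_nbhs; split; last by case.
  by apply: closed_openC; apply: compact_closed => //; exact: norm_hausdorff.
apply: filterS (Ux _ oK) => y nKy /=; rewrite (phi0 x) // subr0.
suff -> : phi y = 0 by rewrite normr0.
have [Oy|] := pselect (Omega y); last exact: phi0.
apply/eqP/negPn/negP => phiy; apply: nKy; split=> //.
exact: subset_closure.
Qed.

End compactly_supported.

(** * Packaging an additive real set function as a charge *)

Section charge_of_additive.
Context {d : measure_display} {T : measurableType d} {R : realType}.
Variable m : set T -> R.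
Hypothesis addm : additive_on measurable m.

(** The proof of additivity is an argument, so that the charge structure can be attached to this
    function. *)
Definition charge_of_additive of additive_on measurable m : set T -> \bar R :=
  fun A => (m A)%:E.
Local Notation mu := (charge_of_additive addm).

Let mu_fin A : measurable A -> mu A \is a fin_num. Proof. by []. Qed.

HB.instance Definition _ := isFinite.Build _ _ _ mu mu_fin.

Let mu_semi_additive : measure_function.semi_additive mu.
Proof.
move=> F n mF /trivIsetP tF _.
elim: n => [|n IH].
  rewrite !big_ord0 /charge_of_additive.
  by rewrite (additive_on0 _ _ _ _ measurable0 addm).
rewrite !big_ord_recr /= -IH /charge_of_additive addm //.
  exact: bigsetU_measurable.
rewrite -bigcup_mkord -subset0 => x [[i /= ni Fi] Fn].
have : (F i `&` F n) x by [].
by rewrite tF // ltn_eqF.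
Qed.

HB.instance Definition _ := isAdditiveCharge.Build _ _ _ mu mu_semi_additive.

Lemma exists_additive_charge :
  exists mu : {additive_charge set T -> \bar R}, forall A, mu A = (m A)%:E.
Proof. by exists mu. Qed.

End charge_of_additive.

(** * Variation of a countably additive charge *)

Section variation_of_charge.
Context {d : measure_display} {T : measurableType d} {R : realType}.
Variable nu : {charge set T -> \bar R}.

(** The variation coming from a Hahn decomposition is a countably additive measure dominating the
    partition sums; finiteness and continuity from above are read off from it. *)
Lemma exists_variation_bound : exists lambda : {measure set T -> \bar R},
  (lambda setT < +oo)%E /\
  forall A, measurable A -> (variation_measure nu A <= lambda A)%E.
Proof.
have [P [N nuPN]] := Hahn_decomposition nu.
exists (charge_variation nuPN); split.
  by rewrite -ge0_fin_numE //; exact: fin_num_measure.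
move=> A mA; apply: ge_ereal_sup => _ [k [Q [mQ tQ QA ->]]].
apply: (@le_trans _ _ (\sum_(i < k) charge_variation nuPN (Q i))%E).
  by apply: lee_sum => i _; exact: abse_charge_variation.
have addl : additive_on measurable (fine \o charge_variation nuPN).
  move=> B C mB mC BC0 /=.
  by rewrite measureU // fineD //; exact: fin_num_measure.
rewrite -QA -[leRHS]fineK; last first.
  by apply: fin_num_measure; rewrite QA.
have /= -> := additive_on_bigcup _ _ _ _ _ _ measurable0 (@measurableU _ _) addl mQ tQ.
rewrite -sumEFin; apply: lee_sum => i _.
by rewrite fineK //; exact: fin_num_measure.
Qed.

Lemma charge_variation_measure_lty : (variation_measure nu setT < +oo)%E.
Proof.
have [lambda [lty le]] := exists_variation_bound.
by apply: le_lt_trans lty; exact: le.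
Qed.

(** Continuity from above of the dominating measure. In the proof of purity, the countable
    additivity of the competing charge enters here. *)
Lemma variation_measure_cvg0 (E : nat -> set T) :
  (forall k, measurable (E k)) -> nonincreasing_seq E ->
  \bigcap_k E k = set0 ->
  forall e : R, 0 < e -> exists k, (variation_measure nu (E k) < e%:E)%E.
Proof.
move=> mE niE E0 e e0; have [lambda [lty le]] := exists_variation_bound.
have lE0 : (lambda (E 0%N) < +oo)%E.
  by apply: le_lt_trans lty; apply: le_measure; rewrite ?inE.
have := nonincreasing_cvg_mu lE0 mE.
rewrite E0 measure0 => /(_ measurable0 niE) lE.
have [lfin /cvgrPdist_lt /(_ _ e0) le'] := (fine_cvgP _ 0).1 lE.
have [k _ kE] := filterI lfin le'.
have [finE Ee] := kE k (leqnn k).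
exists k; apply: le_lt_trans (le _ (mE k)) _.
rewrite -[X in (X < _)%E]fineK // lte_fin.
by move: Ee; rewrite /= sub0r normrN; exact/le_lt_trans/ler_norm.
Qed.

End variation_of_charge.

(** * Preliminaries on ultrafilters and separation *)

Lemma ultra_bigcup_fin (T : Type) (U : set_system T) (I : finType)
    (P : I -> set T) :
  UltraFilter U -> U (\bigcup_i P i) -> exists i, U (P i).
Proof.
move=> UU UP; apply: contrapT => nP.
have nUP i : U (~` P i).
  by have [UPi|//] := in_ultra_setVsetC (P i) UU; case: nP; exists i.
have : U (fun x => forall i, (~` P i) x) by exact: filter_forall.
move=> /(filterI UP); rewrite (_ : _ `&` _ = set0).
  exact: filter_not_empty.
by rewrite -subset0 => x [[i _ Px] /(_ i)].
Qed.

Lemma measurable_closed (R : realType) (n : nat) (A : set 'rV[R]_n) :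
  closed A -> measurable (A : set (borelRn R n)).
Proof.
move=> cA; rewrite -[A]setCK; apply: measurableC.
by apply: measurable_open; exact: closed_openC.
Qed.

(** Normality separates [K] from the complement of [V] by disjoint open sets; the closure of the
    first misses the second. *)
Lemma normal_separation (R : realType) (T : pseudoMetricType R) (K V : set T) :
  closed K -> open V -> K `<=` V ->
  exists O, [/\ open O, K `<=` O & closure O `<=` V].
Proof.
move=> cK oV KV.
have [] := (normal_openP (R := R)).1 (@pseudometric_normal R T) K (~` V) cK
  (open_closedC oV).
  by apply/disjoints_subset; rewrite setCK.
move=> O [W [oO oW KO VW OW0]]; exists O; split=> //.
move=> x Ox; apply: contrapT => nVx.
have [y [Oy Wy]] := Ox W (open_nbhs_nbhs (conj oW (VW _ nVx))).
by have : (O `&` W) y by []; rewrite OW0.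
Qed.

(** * The charge transported from [F] to [Omega] along the ultrafilters *)

Section transported_charge.
Context {R : realType} {n : nat}.
Variables (Omega F : set 'rV[R]_n).
Variables (sigma : {charge set (borelRn R n) -> \bar R}).
Hypothesis mOmega : measurable (Omega : set (borelRn R n)).
Hypothesis cF : closed F.
Hypothesis FOmega0 : lebesgue_Rn (F `&` Omega) = 0%E.
Hypothesis sigmaF : radon_on sigma F.

Variable U : 'rV[R]_n -> set_system 'rV[R]_n.
Hypothesis UF : forall x, F x -> [/\ UltraFilter (U x), U x --> x,
  U x Omega & forall N, lebesgue_Rn N = 0%E -> U x (~` N)].

Variable tau : set 'rV[R]_n -> R.
Hypothesis tau_add : additive_on setT tau.
Hypothesis tauE : forall B : set (borelRn R n),
  measurable B -> tau B = fine (sigma B).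
Hypothesis tau_variation : forall (I : finType) (S : I -> set 'rV[R]_n)
  (B : set (borelRn R n)), measurable B -> trivIset setT S ->
  (forall i, S i `<=` B) ->
  \sum_i `|tau (S i)| <= fine (variation_measure sigma B).

Definition trace (A : set 'rV[R]_n) : set 'rV[R]_n := [set x | F x /\ U x A].

Let mF : measurable (F : set (borelRn R n)) := measurable_closed R n F cF.

Lemma traceI A B : trace (A `&` B) = trace A `&` trace B.
Proof.
apply/seteqP; split=> x.
  move=> [Fx UAB]; have [UU _ _ _] := UF x Fx.
  by split; split=> //; apply: filterS UAB => y [].
move=> [[Fx UA] [_ UB]]; have [UU _ _ _] := UF x Fx.
by split=> //; exact: filterI.
Qed.

(** An ultrafilter contains [A] or its complement, and in the latter case a set [A] united with [B]
    can only be large through [B]. *)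
Lemma traceU A B : trace (A `|` B) = trace A `|` trace B.
Proof.
apply/seteqP; split=> x.
  move=> [Fx UAB]; have [UU _ _ _] := UF x Fx.
  have [UA|UnA] := in_ultra_setVsetC A UU; first by left.
  right; split=> //; apply: filterS (filterI UAB UnA) => y [[//|//]].
by move=> [] [Fx UA]; have [UU _ _ _] := UF x Fx;
  (split; [by []|]); apply: filterS UA => y; [left|right].
Qed.

Lemma trace0 : trace set0 = set0.
Proof.
rewrite -subset0 => x [Fx]; have [UU _ _ _] := UF x Fx.
by move/filter_not_empty.
Qed.

Lemma trace_null A : lebesgue_Rn (A `&` Omega) = 0%E -> trace A = set0.
Proof.
move=> A0; rewrite -subset0 => x [Fx UA]; have [UU _ UO UN] := UF x Fx.
have : U x (A `&` Omega `&` ~` (A `&` Omega)).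
  by apply: filterI; [exact: filterI|exact: UN].
by rewrite setICr => /filter_not_empty.
Qed.

Lemma trace_Omega A : trace (A `&` Omega) = trace A.
Proof.
rewrite traceI; apply: setIidl => x [Fx _].
by have [_ _ UO _] := UF x Fx.
Qed.

(** Together with [trace_open] this squeezes the trace of an open set between its intersection with
    [F] and that of its closure, which makes the regularity of [sigma] usable for [mu]. *)
Lemma trace_closure A : trace A `<=` F `&` closure A.
Proof.
move=> x [Fx UA]; have [UU Ux _ _] := UF x Fx; split=> // B Bx.
exact: filter_ex (filterI UA (Ux _ Bx)).
Qed.

Lemma trace_open A : open A -> F `&` A `<=` trace A.
Proof.
move=> oA x [Fx Ax]; have [UU Ux _ _] := UF x Fx; split=> //.
by apply: Ux; exact: open_nbhs_nbhs.
Qed.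

Lemma tau0 : tau set0 = 0.
Proof. by have -> := additive_on0 _ _ _ _ I tau_add. Qed.

Lemma tau_bigcup (I : finType) (P : I -> set 'rV[R]_n) :
  trivIset setT P -> tau (\bigcup_i P i) = \sum_i tau (P i).
Proof. by move=> tP; apply: additive_on_bigcup tau_add _ tP => //. Qed.

Lemma abs_tau_le A (B : set (borelRn R n)) : measurable B -> A `<=` B ->
  `|tau A| <= fine (variation_measure sigma B).
Proof.
move=> mB AB; have := tau_variation unit (fun=> A) B mB.
by rewrite big_const card_unit /= addr0; apply => // -[] [].
Qed.

Lemma trace_additive_on (C : set (set 'rV[R]_n)) :
  additive_on C (tau \o trace).
Proof.
move=> A B _ _ AB0 /=; rewrite traceU tau_add //.
by rewrite -traceI AB0 trace0.
Qed.

Lemma trivIset_trace (I : Type) (P : I -> set 'rV[R]_n) :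
  trivIset setT P -> trivIset setT (trace \o P).
Proof.
move=> tP i j _ _ [x [Pi Pj]].
have Px : trace (P i `&` P j) x by rewrite traceI.
apply: tP => //; apply: contrapT => /set0P/negP; rewrite negbK => /eqP P0.
by move: Px; rewrite P0 trace0.
Qed.

Variable mu : {additive_charge set (borelRn R n) -> \bar R}.
Hypothesis muE : forall A, mu A = (tau (trace A))%:E.

Lemma trace_charge_carried : carried_by mu Omega.
Proof. by move=> A _; rewrite !muE trace_Omega. Qed.

Lemma trace_charge_bounded : bounded_set_function mu.
Proof.
exists (fine (variation_measure sigma F)) => A _.
by rewrite muE lee_fin; apply: abs_tau_le mF _ => x [].
Qed.

Lemma trace_charge_dominated : ba_dominated mu Omega lebesgue_Rn.
Proof.
split; first by split; [exact: trace_charge_carried|exact: trace_charge_bounded].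
move=> B _ BO B0; rewrite muE trace_null ?tau0 //.
by rewrite (setIidl BO).
Qed.

Let finVsigma (A : set (borelRn R n)) :
  measurable A -> variation_measure sigma A \is a fin_num.
Proof. by apply: variation_measure_fin; exact: charge_variation_measure_lty. Qed.

(** The traces of disjoint sets are disjoint subsets of [F], to which the variation bound of [tau]
    applies. *)
Lemma trace_charge_variation_le (A : set (borelRn R n)) :
  (variation_measure mu A <= variation_measure sigma F)%E.
Proof.
apply: ge_ereal_sup => _ [k [P [mP tP _ ->]]].
under eq_bigr do rewrite muE.
rewrite sumEFin -[leRHS]fineK ?finVsigma // lee_fin.
apply: (tau_variation _ (trace \o P)) => //; first exact: trivIset_trace.
by move=> i x [].
Qed.

Lemma trace_charge_variation_lty : (variation_measure mu setT < +oo)%E.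
Proof.
by apply: le_lt_trans (trace_charge_variation_le _) _; rewrite -ge0_fin_numE
  ?finVsigma ?variation_measure_ge0.
Qed.

(* Disjoint compact pieces carrying most of [sigma] are thickened to disjoint
   open sets; the trace of each lies between the piece and its thickening. *)
Lemma trace_charge_variation_ge :
  (variation_measure sigma F <= variation_measure mu Omega)%E.
Proof.
apply: ge_ereal_sup => _ [k [P [mP tP PF ->]]].
have PiF i : P i `<=` F by rewrite -PF; exact: bigcup_sup.
under eq_bigr do rewrite abs_acharge //.
rewrite sumEFin.
apply/lee_addgt0Pr => e e0.
(* Each of the [k] pieces loses [e'] twice, once passing to [K i] and once passing to the trace;
   [k.+1] avoids a zero denominator. *)
have e'0 : 0 < e / (2 * k.+1%:R) by rewrite divr_gt0 // mulr_gt0.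
set e' := e / _ in e'0.
have [K HK] := boolp.choice (fun i => sigmaF.2 (P i) e' (mP i) (PiF i) e'0).
have [V HV] := boolp.choice HK.
have cK i : closed (K i).
  by have [+ _ _ _ _] := HV i; apply: compact_closed; exact: norm_hausdorff.
have KPs i : K i `<=` P i by have [] := HV i.
move/trivIsetP : tP => tP.
pose rest i := \bigcup_(j in [set j | j != i]) K j.
have crest i : closed (rest i).
  by apply: closed_bigcup => //; exact: finite_finset.
(* The closure of the thickening stays inside [V i] and away from the other compact pieces. *)
have Wex i : exists W, [/\ open W, K i `<=` W &
    closure W `<=` V i `&` ~` rest i].
  have [_ oV KP PV _] := HV i.
  apply: normal_separation => //.
    by apply: openI => //; exact: closed_openC.
  move=> x Kx; split; first by apply: PV; exact: KP.
  move=> [j /= ji Kjx].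
  have : (P j `&` P i) x by split; [exact: KPs|exact: KP].
  by rewrite tP.
have [W HW] := boolp.choice Wex.
(* Removing the closures of the other thickenings makes the sets disjoint, and removes no point of
   [K i], which those closures avoid. *)
pose A i := W i `\` \bigcup_(j in [set j | j != i]) closure (W j).
have oA i : open (A i).
  apply: openI; first by have [] := HW i.
  apply: closed_openC; apply: closed_bigcup => //; first exact: finite_finset.
  by move=> j _; exact: closed_closure.
have AO i : A i `<=` W i by move=> x [].
have tA : trivIset setT A.
  apply/trivIsetP => i j _ _ ij; rewrite -subset0 => x [[_ nAi] [Oj _]].
  by apply: nAi; exists j; rewrite /= 1?eq_sym //; exact: subset_closure.
have KA i : K i `<=` A i.
  move=> x Kx; split; first by have [_ + _] := HW i; exact.
  move=> [j /= ji cOx]; have [_ _ /(_ x cOx)[_]] := HW j; apply.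
  by exists i => //=; rewrite eq_sym.
have mK i : measurable (K i : set (borelRn R n)) by exact: measurable_closed.
have Vsmall i : fine (variation_measure sigma
    ((V i `&` F) `\` K i : set (borelRn R n))) < e'.
  have [_ oV _ _ le] := HV i; rewrite -lte_fin fineK // finVsigma //.
  by apply: measurableD => //; apply: measurableI => //; exact: measurable_open.
have mVFK i : measurable ((V i `&` F) `\` K i : set (borelRn R n)).
  have [_ oV _ _ _] := HV i.
  by apply: measurableD => //; apply: measurableI => //; exact: measurable_open.
have KF i : K i `<=` F by move=> x /KPs /PiF.
(* [B] differs from [K i] by a subset of a set on which [sigma] has variation below [e']. This is
   used for [P i] and for the trace of [A i]. *)
have approx (i : 'I_k) (B : set 'rV[R]_n) : K i `<=` B -> B `<=` V i `&` F ->
    `|tau B - tau (K i)| < e'.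
  move=> KB BVF; rewrite -[X in tau X](setDUK KB) tau_add ?setDIK //.
  rewrite addrAC subrr add0r; apply: le_lt_trans (Vsmall i).
  by apply: abs_tau_le => // x [/BVF]; split.
have Pi_le (i : 'I_k) : `|fine (sigma (P i))| <=
    `|fine (mu (A i))| + e' + e'.
  have [_ oV KP PV _] := HV i.
  have h1 : `|tau (P i) - tau (K i)| < e'.
    by apply: approx => // x Px; split; [exact: PV|exact: (PiF i)].
  have h2 : `|tau (trace (A i)) - tau (K i)| < e'.
    apply: approx => x.
      move=> Kx; apply: trace_open => //; split; [exact: (KF i)|exact: KA].
    move=> /trace_closure[Fx cAx]; split=> //.
    have [_ _ h] := HW i; have [] // := h x.
    by apply: closureS cAx; exact: AO.
  rewrite -tauE // muE /=.
  have : `|tau (P i)| <= `|tau (P i) - tau (K i)| +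
      (`|tau (trace (A i)) - tau (K i)| + `|tau (trace (A i))|).
    rewrite [`|_ (trace _) - _|]distrC.
    rewrite -{1}[tau (P i)](subrK (tau (K i))) (le_trans (ler_normD _ _)) //.
    rewrite lerD2l -{1}[tau (K i)](subrK (tau (trace (A i)))).
    exact: ler_normD.
  lra.
apply: (@le_trans _ _ (\sum_(i < k) (`|fine (mu (A i))| + e' + e'))%:E).
  by rewrite lee_fin; apply: ler_sum => i _; exact: Pi_le.
rewrite !big_split /= -addrA EFinD; apply: leeD.
  (* The open sets [A i] may leave [Omega], so the variation over the whole space is used. *)
  have -> : variation_measure mu Omega = variation_measure mu setT.
    rewrite [RHS](variation_measure_carried mu Omega) ?setTI //.
    exact: trace_charge_carried.
  by apply: sum_le_variation => // i; exact: measurable_open.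
rewrite lee_fin !sumr_const !card_ord -mulrnDl -mulr_natl.
rewrite (_ : k%:R * (e' + e') = e * (k%:R / k.+1%:R)); last first.
  by rewrite /e'; field; rewrite nat1r pnatr_eq0.
apply: ler_piMr; first exact: ltW.
by rewrite ler_pdivrMr // mul1r ler_nat.
Qed.

(** Within [Omega], [mu] lives on each set [G k] minus [F]. These sets decrease to the empty set, so
    [nu] has small variation on them for large [k]. *)
Lemma trace_charge_pure : pure mu Omega.
Proof.
move=> nu _ A mA AO; apply/eqP; rewrite eq_le; apply/andP; split; last first.
  apply: le_ereal_inf_tmp => _ [B [mB BA] <-].
  by rewrite adde_ge0 // variation_measure_ge0 //; exact: measurableD.
apply/lee_addgt0Pr => e e0; rewrite add0e.
pose G k := \bigcup_(x in F) (ball x k.+1%:R^-1)°.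
have oG k : open (G k) by apply: bigcup_open => x _; exact: open_interior.
have mG k : measurable (G k : set (borelRn R n)) by exact: measurable_open.
have FG k : F `<=` G k.
  by move=> x Fx; exists x => //; apply: nbhsx_ballx; rewrite invr_gt0.
pose E k : set (borelRn R n) := A `&` (G k `\` F).
have mE k : measurable (E k).
  by apply: measurableI => //; exact: measurableD.
have niE : nonincreasing_seq E.
  move=> i j ij; apply/subsetPset => x [Ax [[y Fy yx] nFx]]; split=> //.
  split=> //; exists y => //; apply: interiorS yx.
  by apply: le_ball; rewrite lef_pV2 ?posrE // ler_nat.
have E0 : \bigcap_k E k = set0.
  (* A point in every [G k] is a limit of points of [F], hence in the closed set [F]. *)
  rewrite -subset0 => x Ex; have [_ [_ nFx]] := Ex 0%N I.
  apply: nFx; apply: cF => B /nbhs_ballP[r /= r0 rB].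
  have [k _ kr] := near_infty_natSinv_lt (PosNum r0).
  have [_ [[y Fy /interior_subset yx] _]] := Ex k I.
  exists y; split=> //; apply: rB; apply: ball_sym.
  by apply: le_ball yx; apply/ltW; exact: (kr k (leqnn k)).
have [k Ek] := variation_measure_cvg0 nu E mE niE E0 e e0.
(* The infimum is tested with this [B]: [mu] vanishes on its subsets, and [A] minus [B] lies in
   [E k]. *)
pose B : set (borelRn R n) := A `\` E k.
have mB : measurable B by exact: measurableD.
have muB0 : variation_measure mu B = 0%E.
  apply: variation_measure_null => // C mC CB.
  rewrite muE -[trace C]setTI (_ : _ `&` _ = set0) ?tau0 //.
  rewrite setTI -subset0 => x tCx.
  have [Fx UC] := tCx; have [UU Ux _ _] := UF x Fx.
  (* [G k] is an open neighborhood of [F], so intersecting with it loses nothing of the trace; what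
     remains of [C] in [Omega] lies in the null set where [F] meets [Omega]. *)
  have tCG : trace (C `&` G k) x.
    by rewrite traceI; split=> //; apply: trace_open => //; split=> //; exact: FG.
  suff : trace (C `&` G k) = set0 by move=> h; rewrite h in tCG.
  apply: trace_null; apply: lebesgue_Rn_null_sub FOmega0 => y [[Cy Gy] Oy].
  split=> //; apply: contrapT => nFy.
  by have [Ay nEy] := CB y Cy; apply: nEy.
apply: (@le_trans _ _ (variation_measure mu B + variation_measure nu (A `\` B))%E).
  by apply: ereal_inf_lbound; exists B => //; split=> // x [].
rewrite muB0 add0e; apply: le_trans (ltW Ek).
apply: variation_measure_le => //; first exact: measurableD.
by move=> x [Ax nBx]; apply: contrapT => nEx; apply: nBx.
Qed.

Import HBSimple.

(* On [F], the value of [t] along [U x] and the value [t x] are both close to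
   [phi x]. *)
Lemma trace_charge_sintegral_dist (phi : 'rV[R]_n -> R)
    (t : {sfun (borelRn R n) >-> R}) (eta : R) :
  continuous_compact_support Omega phi -> 0 < eta ->
  (forall x, `|t x - phi x| <= eta) ->
  `|fine (sintegral mu t) - fine (sintegral sigma t)| <=
    3 * eta * fine (variation_measure sigma F).
Proof.
move=> phic eta0 tphi.
have [N [r [G [mr tE]]]] := sfun_partition t.
pose P i : set 'rV[R]_n := r @^-1` [set i].
(* [S (i, j)] consists of the points of [F] where [t] is [G i] along [U x] and [G j] at [x]. Both
   integrals become sums over these cells, with weights [G i] and [G j]. *)
pose S (k : 'I_N * 'I_N) := trace (P k.1) `&` P k.2.
have tP : trivIset setT P.
  by move=> i j _ _ [x [/= <- <-]].
have tS : trivIset setT S.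
  move=> [i j] [i' j'] _ _ [x [[/= Pi Pj] [Pi' Pj']]].
  congr (_, _); last by apply: tP => //; exists x.
  by apply: (trivIset_trace _ _ tP) => //; exists x.
have UP : \bigcup_i P i = setT by rewrite -subTset => x _; exists (r x).
have sumS1 i : tau (trace (P i)) = \sum_j tau (S (i, j)).
  rewrite -tau_bigcup /S /=; last exact: trivIset_setIl.
  by rewrite -setI_bigcupr UP setIT.
have sumS2 j : tau (P j `&` F) = \sum_i tau (S (i, j)).
  rewrite -tau_bigcup /S /=; last first.
    by apply: trivIset_setIr; exact: trivIset_trace.
  rewrite -setI_bigcupl setIC (_ : \bigcup_i _ = F) //.
  apply/seteqP; split=> [x [i _ [//]]|x Fx]; have [UU _ _ _] := UF x Fx.
  have [i UPi] : exists i, U x (P i).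
    by apply: ultra_bigcup_fin; rewrite UP; exact: filterT.
  by exists i.
have -> : (t : 'rV[R]_n -> R) = (fun x => G (r x)) by exact/funext.
rewrite (sintegral_partition mu) //; last exact: acharge_additive_on;
  last exact: acharge_fin.
rewrite (sintegral_partition sigma) //; last exact: acharge_additive_on;
  last exact: acharge_fin.
have -> : \sum_i G i * fine (mu (r @^-1` [set i])) =
    \sum_i \sum_j G i * tau (S (i, j)).
  by apply: eq_bigr => i _; rewrite muE /= sumS1 mulr_sumr.
have -> : \sum_i G i * fine (sigma (r @^-1` [set i])) =
    \sum_i \sum_j G j * tau (S (i, j)).
  rewrite exchange_big /=; apply: eq_bigr => j _.
  rewrite sigmaF.1 // -tauE; last exact: measurableI.
  by rewrite -mulr_sumr -sumS2.
rewrite /= !pair_big /= -sumrB.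
apply: le_trans (ler_norm_sum _ _ _) _.
apply: (@le_trans _ _ (\sum_k 3 * eta * `|tau (S k)|)); last first.
  rewrite -mulr_sumr; apply: ler_wpM2l; first by rewrite mulr_ge0 // ltW.
  by apply: tau_variation => // k x [[]].
apply: ler_sum => -[i j] _ /=; rewrite -mulrBl normrM.
have [[x [[Fx UPi] Pj]]|nS] := pselect (S (i, j) !=set0); last first.
  move/set0P/negP : nS; rewrite negbK => /eqP ->.
  by rewrite tau0 normr0 !mulr0.
apply: ler_wpM2r => //.
have [UU Ux UO _] := UF x Fx.
(* A point [y] where [t y = G i] and [phi y] is within [eta] of [phi x] links [G i] to [G j] through
   [phi y] and [phi x]: three errors of size [eta]. *)
have Uphi : U x [set y | `|phi y - phi x| < eta].
  exact: (continuous_compact_support_cvg Omega).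
have [y [Piy yx]] := filter_ex (filterI UPi Uphi).
have := tphi x; have := tphi y; rewrite !tE.
have -> : r x = j by [].
have -> : r y = i by [].
move: yx => /=; rewrite !ltr_norml !ler_norml => /andP[? ?] /andP[? ?] /andP[? ?].
by apply/andP; split; lra.
Qed.

(** Both integrals exist because [phi] is a uniform limit of simple functions. They agree because
    the two integrals of an approximation within [eta] differ by a multiple of [eta]. *)
Lemma trace_charge_integral (phi : 'rV[R]_n -> R) :
  continuous_compact_support Omega phi ->
  exists I : R, is_integral mu Omega phi I /\ is_integral sigma F phi I.
Proof.
move=> phic.
have [M phiM] := continuous_compact_support_bounded Omega phi phic.
have mphi := continuous_compact_support_measurable Omega phi phic mOmega.
have app (eta : R) : 0 < eta -> exists t : {sfun (borelRn R n) >-> R},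
    forall x, `|t x - phi x| <= eta.
  exact: sfun_uniform_approx mphi phiM.
have finVmu := trace_charge_variation_lty.
have finVs := charge_variation_measure_lty sigma.
have [a Ha] := exists_uniform_integral mu finVmu phi app.
have [b Hb] := exists_uniform_integral sigma finVs phi app.
suff ab : a = b.
  exists a; split; apply: is_integral_uniform => //.
  - exact: trace_charge_carried.
  - exact: sigmaF.1.
  - by rewrite ab.
set Wm := fine (variation_measure mu setT) in Ha.
set Ws := fine (variation_measure sigma setT) in Hb.
(* The three terms bound, up to the factor [eta], the errors from [a] to the [mu]-integral of [t],
   on to its [sigma]-integral, and on to [b]. *)
pose c := Wm + 3 * fine (variation_measure sigma F) + Ws.
have c0 : 0 <= c.
  by rewrite !addr_ge0 ?mulr_ge0 // fine_ge0 // variation_measure_ge0.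
apply/eqP; rewrite -subr_eq0 -normr_le0.
apply/ler_addgt0Pr => e e0; rewrite add0r.
have eta0 : 0 < e / (c + 1) by rewrite divr_gt0 // ltr_wpDl.
set eta := e / _ in eta0.
have [t tphi] := app _ eta0.
have ha := Ha _ _ eta0 tphi; have hb := Hb _ _ eta0 tphi.
have hd := trace_charge_sintegral_dist phi t eta phic eta0 tphi.
have : `|a - b| <= eta * c.
  rewrite ler_norml /c !mulrDr; move: ha hb hd.
  by rewrite !ler_norml => /andP[? ?] /andP[? ?] /andP[? ?]; apply/andP; split; nra.
move=> /le_trans; apply; rewrite /eta mulrAC ler_pdivrMr ?ltr_wpDl //.
by rewrite ler_pM2l // lerDl.
Qed.

End transported_charge.

Theorem corollary5p28 (R : realType) (n : nat) (Omega F : set 'rV[R]_n)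
    (sigma : {charge set (borelRn R n) -> \bar R}) :
  measurable (Omega : set (borelRn R n)) ->
  bounded_set Omega ->
  closed F ->
  F `<=` closure Omega ->
  (forall (x : 'rV[R]_n) (delta : R), F x -> 0 < delta ->
    (0 < lebesgue_Rn (euclidean_ball x delta `&` Omega))%E) ->
  lebesgue_Rn (F `&` Omega) = 0%E ->
  radon_on sigma F ->
  exists mu : {additive_charge set (borelRn R n) -> \bar R},
    [/\ ba_dominated mu Omega lebesgue_Rn,
        forall phi : 'rV[R]_n -> R, continuous_compact_support Omega phi ->
          exists I : R, is_integral mu Omega phi I /\ is_integral sigma F phi I,
        variation_measure mu Omega = variation_measure sigma F &
        pure mu Omega].
Proof.
move=> mO _ cF _ Fpos FO0 sF.
have [U HU] : exists U : 'rV[R]_n -> set_system 'rV[R]_n, forall x, F x ->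
    [/\ UltraFilter (U x), U x --> x, U x Omega &
      forall N, lebesgue_Rn N = 0%E -> U x (~` N)].
  have ex x : exists V : set_system 'rV[R]_n, F x ->
      [/\ UltraFilter V, V --> x, V Omega &
        forall N, lebesgue_Rn N = 0%E -> V (~` N)].
    (* Outside [F] the neighborhood filter is a mere placeholder, of which nothing is claimed. *)
    have [Fx|nFx] := pselect (F x); last by exists (nbhs x).
    have [V HV] := exists_density_ultrafilter Omega x (fun e => Fpos x e Fx).
    by exists V.
  by have [U HU] := boolp.choice ex; exists U.
have [tau [tau_add tauE tau_var]] :=
  additive_extension sigma (charge_variation_measure_lty sigma).
have [mu muE] := @exists_additive_charge _ (borelRn R n) R _
  (trace_additive_on Omega F U HU tau tau_add (@measurable _ (borelRn R n))).
exists mu; split.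
- exact: (trace_charge_dominated Omega F sigma cF U HU tau).
- exact: (trace_charge_integral Omega F sigma mO cF sF U HU tau).
- apply/eqP; rewrite eq_le; apply/andP; split.
    exact: (trace_charge_variation_le Omega F sigma cF U HU tau).
  exact: (trace_charge_variation_ge Omega F sigma mO cF sF U HU tau).
- exact: (trace_charge_pure Omega F cF FO0 U HU tau).
Qed.
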